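(* There is an algorithm that, given a digraph $D$ on $n$ vertices and a positive integer $k$, decides whether $D$ has an out-branching with at least $k$ leaves (the problem $k$-Leaf Out-Branching) in time $2^{O(k\log k)}\cdot n^{O(1)}$.
   Context: An out-tree of a digraph $D$ is a subgraph of $D$ that is a tree (ignoring arc directions) in which exactly one vertex, the root, has in-degree $0$ and every other vertex has in-degree $1$. An out-branching is an out-tree containing all vertices of $D$. A leaf is a vertex of out-degree $0$ in the out-tree. *)

(* Defs.v *)
From mathcomp Require Import all_boot.
Set Implicit Arguments. Unset Strict Implicit. Unset Printing Implicit Defensive.

(* Digraphs: a digraph on n vertices is a vertex type 'I_n together    *)
(* with an arc relation  a : rel 'I_n  (a x y  <=>  x -> y is an arc).  *)
(* A subgraph spanning all vertices is given by a sub-relation B of a. *)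
Section Digraph.
Variable n : nat.
Implicit Types (B : rel 'I_n).

Definition undirected B : rel 'I_n := fun x y => B x y || B y x.

Definition indeg B (v : 'I_n) : nat := #|[set u | B u v]|.
Definition outdeg B (v : 'I_n) : nat := #|[set w | B v w]|.

(* The underlying (multi)graph of B has no cycle: no loop, no pair of
   opposite arcs (a 2-cycle of parallel edges), and no cycle through
   >= 3 distinct vertices. *)
Definition acyclic_undirected B : Prop :=
  [/\ forall x, ~~ B x x,
      forall x y, ~~ (B x y && B y x)
    & forall s : seq 'I_n, uniq s -> 2 < size s -> ~~ cycle (undirected B) s].

Definition connected_undirected B : Prop :=
  forall x y, connect (undirected B) x y.

Definition is_tree_undirected B : Prop :=
  connected_undirected B /\ acyclic_undirected B.

Definition out_branching (a : rel 'I_n) B : Prop :=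
  [/\ subrel B a,
      is_tree_undirected B
    & exists r, indeg B r = 0 /\ forall v, v != r -> indeg B v = 1].

Definition leaves B : {set 'I_n} := [set v | outdeg B v == 0].

Definition has_k_leaf_out_branching (a : rel 'I_n) (k : nat) : Prop :=
  exists B : rel 'I_n, out_branching a B /\ k <= #|leaves B|.
End Digraph.

(* Model of computation: a unit-cost RAM with addition and truncated   *)
(* subtraction, constants, indirect addressing and conditional jumps.  *)
(* (Polynomially equivalent to Turing machines, Cook-Reckhow 1973.)    *)
Inductive instr : Type :=
| IConst of nat & nat
| IAdd of nat & nat & nat
| ISub of nat & nat & nat
| ILoad of nat & nat
| IStore of nat & nat
| IJz of nat & nat
| IHalt.

Definition memory := nat -> nat.
Definition upd (m : memory) (p v : nat) : memory :=
  fun q => if q == p then v else m q.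

Definition step (i : instr) (pc : nat) (m : memory) : nat * memory :=
  match i with
  | IConst r v => (pc.+1, upd m r v)
  | IAdd r x y => (pc.+1, upd m r (m x + m y))
  | ISub r x y => (pc.+1, upd m r (m x - m y))
  | ILoad r x => (pc.+1, upd m r (m (m x)))
  | IStore x r => (pc.+1, upd m (m x) (m r))
  | IJz r l => (if m r == 0 then l else pc.+1, m)
  | IHalt => (pc, m)
  end.

Fixpoint exec (P : seq instr) (t : nat) (pc : nat) (m : memory)
  : option memory :=
  match nth IHalt P pc with
  | IHalt => Some m
  | i => match t with
         | 0 => None
         | t'.+1 => let: (pc', m') := step i pc m in exec P t' pc' m'
         end
  end.

(* Input encoding of an instance (D, k), D = ('I_n, a):
   R[0] = n, R[1] = k, R[2 + i*n + j] = 1 if (i,j) is an arc, else 0;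
   all other registers 0.  The answer is read in R[0] (1 = yes). *)
Definition encode (n : nat) (a : rel 'I_n) (k : nat) : memory :=
  fun p =>
    if p == 0 then n else if p == 1 then k else
    let q := p - 2 in
    if q < n * n then
      match insub (q %/ n) : option 'I_n, insub (q %% n) : option 'I_n with
      | Some i, Some j => nat_of_bool (a i j)
      | _, _ => 0
      end
    else 0.

(* Main.v *)
Require Import Defs.
From mathcomp Require Import all_boot.
From mathcomp Require Import zify.
Set Implicit Arguments. Unset Strict Implicit. Unset Printing Implicit Defensive.

(* An out-branching with at least k leaves exists iff some root r reaches every
   vertex and some set S of internal vertices, each reachable from r inside S,
   has at least k vertices on its fringe (its out-neighbours outside S).  Such a
   set is grown from the empty one by the branching of Kneis, Langer and
   Rossmanith: a fringe vertex u either stays a leaf for good or becomes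
   internal, which adds its unseen out-neighbours to the fringe.  If u has to
   become internal and adds a single new vertex v, then v has to become internal
   as well, since otherwise u could be a leaf in place of v.  Hence each genuine
   choice increases (fringe size) + (number of permanent leaves), and fewer than
   2k binary choices are made before the fringe reaches size k.  The RAM program
   tries, for each root, all strings of 2k choices, one after the other, together
   with the string of all ones, which amounts to a graph search from the root. *)

(** * Out-branchings and fringes *)

Section Fringe.
Variables (n : nat) (a : rel 'I_n) (r : 'I_n).
Implicit Types (S I X : {set 'I_n}) (u v : 'I_n).

Definition fringe S : {set 'I_n} :=
  [set v | (v \notin S) && ((v == r) || [exists u, (u \in S) && a u v])].

Definition rooted S : Prop :=
  forall X, (r \in S -> r \in X) ->
    (forall x y, x \in S -> x \in X -> y \in S -> a x y -> y \in X) ->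
  S \subset X.

Lemma fringeP S v :
  reflect (v \notin S /\ (v = r \/ exists2 u, u \in S & a u v)) (v \in fringe S).
Proof.
rewrite inE; apply: (iffP andP) => [[vS H]|[vS vF]]; split=> //.
  case/orP: H => [/eqP->|/existsP[u /andP[uS uv]]]; [by left|by right; exists u].
case: vF => [->|[u uS uv]]; first by rewrite eqxx.
by apply/orP; right; apply/existsP; exists u; rewrite uS.
Qed.

Lemma root_seen S : r \in S :|: fringe S.
Proof.
rewrite inE; case: (boolP (r \in S)) => //= rS.
by apply/fringeP; split=> //; left.
Qed.

Lemma out_seen S u v : u \in S -> a u v -> v \in S :|: fringe S.
Proof.
move=> uS uv; rewrite inE; case: (boolP (v \in S)) => //= vS.
by apply/fringeP; split=> //; right; exists u.
Qed.

Lemma rooted0 : rooted set0.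
Proof. by move=> X _ _; rewrite sub0set. Qed.

Lemma fringe0 : fringe set0 = [set r].
Proof.
apply/setP=> v; rewrite [RHS]inE; apply/fringeP/eqP; last by move=> ->; rewrite inE; split; [|left].
by case=> _ [//|[u]]; rewrite inE.
Qed.

Lemma rooted_expand I u : rooted I -> u \in fringe I -> rooted (u |: I).
Proof.
move=> cI /fringeP[uI uF] X rX clX.
have sIX : I \subset X.
  apply: cI => [rI|x y xI xX yI xy]; first by apply: rX; rewrite !inE rI orbT.
  by apply: clX xy => //; rewrite !inE ?xI ?yI orbT.
rewrite subUset sIX andbT sub1set.
case: uF => [uE|[x xI xu]]; first by rewrite uE; apply: rX; rewrite uE setU11.
by apply: clX xu; rewrite ?(subsetP sIX) // !inE ?eqxx // xI orbT.
Qed.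

Definition news u (seen : {set 'I_n}) : seq 'I_n :=
  [seq v <- enum 'I_n | a u v && (v \notin seen)].

Lemma mem_news u X v : (v \in news u X) = a u v && (v \notin X).
Proof. by rewrite mem_filter mem_enum andbT. Qed.

Lemma news_uniq u X : uniq (news u X).
Proof. by rewrite filter_uniq // enum_uniq. Qed.

Lemma fringe_expand I u : u \in fringe I ->
  fringe (u |: I) = fringe I :\ u :|: [set v in news u (I :|: fringe I)].
Proof.
move=> uF; apply/setP=> v; rewrite !inE mem_filter mem_enum andbT !inE.
rewrite negb_or; case: (eqVneq v u) => [->|vu] /=.
  by move: uF; rewrite inE; case: (u \in I) => //= ->; rewrite andbF.
case: (boolP (v \in I)) => vI //=; first by rewrite andbF.
case: (eqVneq v r) => //= vr.
apply/existsP/orP => [[x /andP[]]|].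
  rewrite !inE => /orP[/eqP-> uv|xI xv]; last by left; apply/existsP; exists x; rewrite xI.
  by case: (boolP [exists _, _]) => _; [left|right; rewrite uv].
case=> [/existsP[x /andP[xI xv]]|/andP[uv _]]; first by exists x; rewrite !inE xI orbT.
by exists u; rewrite !inE eqxx.
Qed.

Lemma seen_expand I u : u \in fringe I ->
  (u |: I) :|: fringe (u |: I) =
  (I :|: fringe I) :|: [set v in news u (I :|: fringe I)].
Proof.
move=> uF; rewrite fringe_expand //; apply/setP=> v.
move: (news u _) => s; rewrite !in_setU in_setD1 in_set1.
by case: (eqVneq v u) => [->|_] /=; rewrite ?uF ?orbT //= orbA.
Qed.

Lemma card_fringe_expand I u : u \in fringe I ->
  #|fringe (u |: I)| = #|fringe I|.-1 + size (news u (I :|: fringe I)).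
Proof.
move=> uF; rewrite fringe_expand // cardsU disjoint_setI0 ?cards0 ?subn0.
  rewrite (cardsD1 u (fringe I)) uF /=; congr (_ + _).
  by rewrite -(card_uniqP (news_uniq u (I :|: fringe I))) cardsE.
rewrite disjoint_subset; apply/subsetP=> v; rewrite in_setD1 => /andP[_ vF].
by rewrite inE /= inE mem_news !in_setU vF orbT andbF.
Qed.

(* A vertex whose new out-neighbours contribute at most one fringe vertex that
   stays outside [S] can be turned into a leaf without loss. *)
Lemma rooted_exchange I S u : rooted I -> rooted S -> I \subset S ->
  u \in fringe I -> u \in S ->
  (forall v, v \in news u (I :|: fringe I) -> v \notin S) ->
  size (news u (I :|: fringe I)) <= 1 ->
  rooted (S :\ u) /\ #|fringe S| <= #|fringe (S :\ u)|.
Proof.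
move=> cI cS sIS uF uS nS n1.
have uI : u \notin I by case/fringeP: uF.
have sIS' : I \subset S :\ u by rewrite subsetD1 sIS.
have old v : a u v -> v \in S -> v \in I :|: fringe I.
  move=> uv vS; apply: contraLR vS => vF; apply: nS.
  by rewrite mem_news uv.
split.
  move=> X rX clX.
  have sIX : I \subset X.
    apply: cI => [rI|x y xI xX yI xy]; first exact/rX/(subsetP sIS').
    by apply: clX xy; rewrite ?(subsetP sIS').
  suff: S \subset u |: X.
    move/subsetP=> H; apply/subsetP=> v; rewrite !inE => /andP[vu /H].
    by rewrite !inE (negPf vu).
  apply: cS => [rS|x y xS xX yS xy].
    by rewrite !inE; case: eqVneq => //= ru; apply: rX; rewrite !inE ru.
  rewrite !inE; case: (eqVneq y u) => //= yu.
  case: (eqVneq x u) xX xy => [-> _ uy|xu].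
    have := old y uy yS; rewrite in_setU => /orP[/(subsetP sIX)//|/fringeP[_]].
    case=> [yr|[z zI zy]]; first by rewrite yr in yu yS *; apply: rX; rewrite !inE yu.
    apply: (clX z y) => //; [exact: (subsetP sIS')|exact: (subsetP sIX)|].
    by rewrite !inE yu.
  rewrite !inE (negPf xu) /= => xX; apply: clX xX _; rewrite !inE ?xu ?yu //.
set N := [set v in news u (I :|: fringe I)].
have cN : #|N| <= 1 by rewrite cardsE (card_uniqP (news_uniq _ _)).
have sF : u |: (fringe S :\: N) \subset fringe (S :\ u).
  rewrite subUset sub1set; apply/andP; split.
    apply/fringeP; rewrite !inE eqxx; split=> //.
    case/fringeP: uF => _ [->|[x xI xu]]; [by left|right; exists x => //].
    by apply: (subsetP sIS').
  apply/subsetP=> v; rewrite inE => /andP[vN /fringeP[vS vF]].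
  apply/fringeP; split; first by rewrite !inE (negPf vS) andbF.
  case: vF => [->|[x xS xv]]; first by left.
  case: (eqVneq x u) xv => [-> uv|xu xv]; last by right; exists x; rewrite // !inE xu.
  move: vN; rewrite inE mem_news uv /= negbK in_setU.
  case/orP=> [/(subsetP sIS)|]; first by rewrite (negPf vS).
  case/fringeP=> _ [|[z zI zv]]; [by left|right; exists z => //].
  exact: (subsetP sIS').
apply: leq_trans (subset_leq_card sF).
have uF' : u \notin fringe S :\: N by rewrite in_setD; apply/negP=> /andP[_ /fringeP[]]; rewrite uS.
rewrite cardsU1 uF'.
have := subset_leq_card (subsetIr (fringe S) N); rewrite -(cardsID N (fringe S)).
by move=> le; rewrite leq_add2r (leq_trans le).
Qed.

(* Greedily expanding fringe vertices that have new out-neighbours never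
   shrinks the fringe. *)
Lemma rooted_spanning S : (forall v, connect a r v) -> rooted S ->
  exists S', [/\ rooted S', #|fringe S| <= #|fringe S'| & S' :|: fringe S' = setT].
Proof.
move=> reach; have [m] := ubnP (n - #|S|); elim: m S => // m IH S ltm cS.
case: (boolP [exists u in fringe S, news u (S :|: fringe S) != [::]]).
  case/exists_inP=> u uF nw.
  have [uS _] := fringeP _ _ uF.
  have := max_card (u |: S); rewrite cardsU1 uS card_ord => cu.
  case: (IH (u |: S)); [by rewrite cardsU1 uS; lia|exact: rooted_expand|].
  move=> S' [cS' le1 full]; exists S'; split=> //; apply: leq_trans le1.
  rewrite card_fringe_expand // -[X in X <= _]prednK; last by rewrite card_gt0; apply/set0Pn; exists u.
  by case: (news _ _) nw => //= *; lia.
rewrite negb_exists_in => /forall_inP nonew.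
exists S; split=> //; apply/setP=> v; rewrite in_setT.
have cl x y : x \in S :|: fringe S -> a x y -> y \in S :|: fringe S.
  rewrite in_setU => /orP[xS xy|xF xy]; first exact: (out_seen xS).
  apply/negPn/negP=> yF; have := nonew x xF; rewrite negbK => /eqP nil.
  by have : y \in news x (S :|: fringe S); [rewrite mem_news xy|rewrite nil].
case/connectP: (reach v) => p pp ->; elim: p (r) (root_seen S) pp => //= y p IHp x xF.
by case/andP=> xy; apply: IHp; apply: cl xy.
Qed.

Lemma parent_out_branching (p : 'I_n -> 'I_n) (rk : 'I_n -> nat) :
  (forall v, v != r -> a (p v) v /\ rk (p v) < rk v) ->
  out_branching a (fun x y => (y != r) && (x == p y)).
Proof.
move=> pP; set B : rel 'I_n := fun x y => _.
have Brk x y : B x y -> rk x < rk y by case/andP=> /pP[_ ?] /eqP->.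
have to_root v : connect (undirected B) r v.
  have [m] := ubnP (rk v); elim: m v => // m IH v ltm.
  case: (eqVneq v r) => [->|vr]; first exact: connect0.
  have [_ lt] := pP v vr.
  apply: connect_trans (IH (p v) _) (connect1 _); first by lia.
  by rewrite /undirected /B vr eqxx.
have sym : connect_sym (undirected B).
  by apply: sym_connect_sym => x y; rewrite /undirected orbC.
split.
- by move=> x y /andP[yr /eqP->]; case: (pP y yr).
- split; first by move=> x y; apply: connect_trans (to_root y); rewrite sym.
  split.
  + by move=> x; apply/negP => /Brk; rewrite ltnn.
  + by move=> x y; apply/negP => /andP[/Brk ? /Brk]; lia.
  + move=> s us s2; apply/negP => cyc.
    have [x0 x0s] : exists x0, x0 \in s by case: s s2 {us cyc} => // x0 s _; exists x0; rewrite inE eqxx.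
    case: (@arg_maxnP _ x0 (mem s) rk x0s) => x xs xmax.
    have {}xs : x \in s := xs.
    case: (rot_to xs) => i s' rots.
    have mem_s y : (y \in s) = (y \in x :: s') by rewrite -rots mem_rot.
    have : uniq (x :: s') by rewrite -rots rot_uniq.
    have : 2 < size (x :: s') by rewrite -rots size_rot.
    have : cycle (undirected B) (x :: s') by rewrite -rots rot_cycle.
    have par y : y \in s -> undirected B x y || undirected B y x -> y = p x.
      move=> ys; rewrite /undirected.
      have := xmax y ys => /= le.
      have nB : B x y = false by apply/negP=> /Brk; lia.
      by rewrite nB /= orbF orbb => /andP[_ /eqP].
    case: s' rots mem_s => // y s' rots mem_s /=.
    case/lastP: s' rots mem_s => // s' z rots mem_s.
    rewrite rcons_path last_rcons => /andP[xy /andP[_ zx]] _ /and3P[_ yz _].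
    have yE : y = p x by apply: par; rewrite ?xy // mem_s !inE eqxx orbT.
    have zE : z = p x by apply: par; rewrite ?zx ?orbT // mem_s !inE mem_rcons inE eqxx !orbT.
    by rewrite yE -zE mem_rcons inE eqxx in yz.
- exists r; split=> [|v vr].
    by apply/eqP; rewrite cards_eq0; apply/eqP/setP=> x; rewrite !inE /B eqxx.
  rewrite /indeg -(cards1 (p v)); apply: eq_card => x.
  by rewrite !inE /B vr.
Qed.

Lemma rooted_parent S : rooted S ->
  exists rk : 'I_n -> nat, forall v, v \in S -> v != r ->
    exists u, [/\ u \in S, a u v & rk u < rk v].
Proof.
move=> cS; pose e := [rel x y | a x y && (y \in S)].
pose reachin v i := [exists t : i.-tuple 'I_n, path e r t && (last r t == v)].
have reachinP v t : path e r t -> last r t = v -> reachin v (size t).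
  by move=> pt lt; apply/existsP; exists (in_tuple t); rewrite pt lt eqxx.
have con v : v \in S -> connect e r v.
  move=> vS; suff /subsetP/(_ v vS) : S \subset [set v | connect e r v] by rewrite inE.
  apply: cS => [_|x y xS]; rewrite !inE ?connect0 // => rx yS xy.
  by apply: connect_trans rx (connect1 _); rewrite /= xy.
have ex v : exists i, ~~ connect e r v || reachin v i.
  case: (boolP (connect e r v)) => [/connectP[t pt lt]|_]; last by exists 0.
  by exists (size t); exact: reachinP.
exists (fun v => ex_minn (ex v)) => v vS vr.
have rS : r \in S.
  apply: contraLR vS => rS; have/subsetP/(_ v) : S \subset set0.
    by apply: cS => [|x y _]; [rewrite (negPf rS)|rewrite inE].
  by rewrite inE; case: (v \in S) => // /(_ isT).
case: (ex_minnP (ex v)) => i; rewrite con //= => /existsP[t /andP[pt /eqP lt]] _.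
move: (size_tuple t) pt lt; case/lastP: {t}(tval t) => [_ _ /= rv|t w].
  by rewrite rv eqxx in vr.
rewrite size_rcons rcons_path last_rcons => <- /andP[pt /andP[uw wS]] wv.
exists (last r t); rewrite -wv; split=> //.
  case/lastP: t pt {uw} => // t u; rewrite rcons_path last_rcons => /andP[_ /andP[]] //.
case: ex_minnP => j _; apply.
by rewrite reachinP // orbT.
Qed.

Lemma rooted_has_leaves k S : (forall v, connect a r v) -> rooted S ->
  k <= #|fringe S| -> has_k_leaf_out_branching a k.
Proof.
move=> reach cS kS; have [{cS}S' [cS leS full]] := rooted_spanning reach cS.
have [rk rkP] := rooted_parent cS.
pose rk' v := if v \in S' then rk v else (\max_u rk u).+1.
have ex v : v != r -> exists u, [&& u \in S', a u v & rk' u < rk' v].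
  move=> vr; rewrite /rk'; case: (boolP (v \in S')) => vS.
    by have [u [uS uv lt]] := rkP v vS vr; exists u; rewrite uS uv.
  have := in_setT v; rewrite -full in_setU (negPf vS) => /fringeP[_ [vE|[u uS uv]]].
    by rewrite vE eqxx in vr.
  by exists u; rewrite uS uv ltnS (leq_bigmax_cond).
pose p v := odflt r [pick u | [&& u \in S', a u v & rk' u < rk' v]].
have pP v : v != r -> [&& p v \in S', a (p v) v & rk' (p v) < rk' v].
  move=> /ex[u uP]; rewrite /p; case: pickP => [//|/(_ u)].
  by rewrite uP.
exists (fun x y => (y != r) && (x == p y)); split.
  by apply: (@parent_out_branching _ rk') => v /pP /and3P[].
apply: leq_trans kS (leq_trans leS _); apply/subset_leq_card/subsetP=> v /fringeP[vS _].
rewrite inE /outdeg cards_eq0; apply/eqP/setP=> w; rewrite !inE.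
by apply/negP=> /andP[/pP /and3P[+ _ _] /eqP vE]; rewrite -vE (negPf vS).
Qed.

End Fringe.

Lemma has_leaves_rooted n (a : rel 'I_n) k : has_k_leaf_out_branching a k ->
  exists r, (forall v, connect a r v) /\
    exists2 S, rooted a r S & k <= #|fringe a r S|.
Proof.
case=> B [[sBa [conn _] [r [r0 deg1]]] kB].
have noin x : B x r = false.
  by move/eqP: r0; rewrite cards_eq0 => /eqP/setP/(_ x); rewrite !inE.
have uniq_in v x y : B x v -> B y v -> x = y.
  case: (eqVneq v r) => [->|vr]; first by rewrite noin.
  move=> xv yv; have/eqP/cards1P[z zE] := deg1 v vr.
  by move/setP: zE => zE; have := zE x; have := zE y; rewrite !inE xv yv => /esym/eqP-> /esym/eqP.
have last_arc v : connect B r v -> v = r \/ exists2 x, connect B r x & B x v.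
  case/connectP=> p; case/lastP: p => [_ ->|p x]; first by left.
  rewrite rcons_path last_rcons => /andP[pp xv] ->; right; exists (last r p) => //.
  by apply/connectP; exists p.
have reach v : connect B r v.
  case/connectP: (conn r v) => p pp ->.
  move: {2 3 5}r (connect0 B r) pp => x rx; elim: p x rx => //= y p IH x rx /andP[xy].
  apply: IH.
  case/orP: xy => xy; first exact: connect_trans rx (connect1 xy).
  case: (last_arc x rx) => [xr|[z rz zx]]; first by rewrite xr noin in xy.
  by rewrite (uniq_in x y z).
exists r; split=> [v|].
  by apply: connect_sub (reach v) => x y /sBa; apply: connect1.
pose S := [set v | outdeg B v != 0].
have outS x y : B x y -> x \in S.
  by move=> xy; rewrite inE cards_eq0; apply/set0Pn; exists y; rewrite inE.
exists S.
  move=> X rX clX; apply/subsetP=> v.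
  case/connectP: (reach v) => p; elim/last_ind: p v => [v _ -> /rX //|p x IH v].
  rewrite rcons_path last_rcons => /andP[pp px] -> xS.
  by apply: clX (sBa _ _ px) => //; [apply: outS px|apply: IH (outS _ _ px)].
apply: leq_trans kB _; apply/subset_leq_card/subsetP=> v; rewrite inE => v0.
apply/fringeP; rewrite inE negbK v0; split=> //.
case: (last_arc v (reach v)) => [|[x _ xv]]; [by left|right; exists x].
  exact: outS xv.
exact: sBa.
Qed.

(** * The branching search *)

(* [frac L bs] is the binary fraction 0.bs scaled by [2 ^ L]; doubling it and
   subtracting [2 ^ L] on overflow reads off the bits of [bs] in order. *)
Fixpoint frac (L : nat) (bs : seq bool) : nat :=
  if bs is b :: bs' then b * 2 ^ L.-1 + frac L.-1 bs' else 0.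

Definition next_bit (K w : nat) : bool * nat :=
  (K <= w + w, w + w - (K <= w + w) * K).

Lemma frac_lt L bs : size bs <= L -> frac L bs < 2 ^ L.
Proof.
elim: bs L => [|b bs IH] [|L] //= le; first by rewrite expn_gt0.
by have := IH L le; rewrite expnS; case: b => /=; lia.
Qed.

Lemma fracS L bs : size bs <= L -> frac L.+1 bs = frac L bs + frac L bs.
Proof.
elim: bs L => [|b bs IH] [|L] //= le; have /= -> := IH L le.
by rewrite expnS; case: b; lia.
Qed.

Lemma next_bit_frac L b bs : size bs < L ->
  next_bit (2 ^ L) (frac L (b :: bs)) = (b, frac L bs).
Proof.
case: L => // L le; rewrite /next_bit /= (fracS le) expnS.
have := frac_lt le; case: b => /= lt.
  by rewrite (_ : (_ <= _) = true) ?mul1n; [congr pair; lia|apply/idP; lia].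
by rewrite (_ : (_ <= _) = false) ?mul0n ?subn0 //; apply/negbTE; lia.
Qed.

Lemma next_bit_full K : next_bit K K = (true, K).
Proof. by rewrite /next_bit leq_addr mul1n addnK. Qed.

Section Search.
Variables (n : nat) (a : rel 'I_n) (k K : nat).

(* [lf] is the size of the fringe and [d] the number of vertices pushed by the
   last expansion; when [d = 1] the top of the stack must be expanded. *)
Record state := State {
  stk : seq 'I_n; seen : {set 'I_n}; lf : nat; d : nat; wd : nat; fnd : bool }.

Definition expand u q (st : state) w' : state :=
  let nw := news a u (seen st) in
  State (nw ++ q) (seen st :|: [set v in nw]) ((lf st).-1 + size nw) (size nw) w'
        (fnd st || (k <= (lf st).-1 + size nw)).

Definition skip q (st : state) w' : state :=
  State q (seen st) (lf st) 0 w' (fnd st).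

Definition search_step (st : state) : state :=
  if stk st is u :: q then
    let bw := if d st == 1 then (true, wd st) else next_bit K (wd st) in
    if bw.1 then expand u q st bw.2 else skip q st bw.2
  else st.

Definition search_init (r : 'I_n) (w : nat) : state :=
  State [:: r] [set r] 1 0 w (k <= 1).

Definition search_end r w := iter n search_step (search_init r w).

Definition mass st := size (stk st) + (n - #|seen st|).

Lemma card_expand u q st w' :
  #|seen (expand u q st w')| = #|seen st| + size (news a u (seen st)).
Proof.
rewrite cardsU cardsE (card_uniqP (news_uniq a u (seen st))).
suff -> : seen st :&: [set v in news a u (seen st)] = set0 by rewrite cards0 subn0.
by apply/setP=> v; rewrite in_setI in_set0 inE mem_news; case: (v \in _); rewrite ?andbF.
Qed.

Lemma mass_expand u q st w' : stk st = u :: q -> mass st = (mass (expand u q st w')).+1.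
Proof.
move=> E; have := max_card (mem (seen (expand u q st w'))).
rewrite /mass card_expand card_ord E /= size_cat; lia.
Qed.

Lemma mass_step st : stk st != [::] -> mass st = (mass (search_step st)).+1.
Proof.
rewrite /search_step; case E: (stk st) => [//|u q] _.
by case: ifP => _; [apply: mass_expand|rewrite /mass E].
Qed.

Lemma fnd_step st : fnd st -> fnd (search_step st).
Proof.
move=> f; rewrite /search_step; case: (stk st) => // u q.
by case: ifP => _ //=; rewrite f.
Qed.

Lemma fnd_iter m st : fnd st -> fnd (iter m search_step st).
Proof. by move=> f; elim: m => //= m; apply: fnd_step. Qed.

Lemma stk_nil_iter m st : stk st = [::] -> iter m search_step st = st.
Proof. by move=> E; elim: m => //= m ->; rewrite /search_step E. Qed.

Lemma stk_iter_mass st : stk (iter (mass st) search_step st) = [::].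
Proof.
move E: (mass st) => m; elim: m st E => [|m IH] st E.
  by apply/eqP; rewrite -size_eq0; move/eqP: E; rewrite addn_eq0 => /andP[].
case: (eqVneq (stk st) [::]) => [nil|nnil]; first by rewrite stk_nil_iter.
by rewrite iterSr IH //; have := mass_step nnil; rewrite E => -[].
Qed.

Lemma mass_init r w : mass (search_init r w) = n.
Proof. by rewrite /mass /= cards1; case: (n) r => [[]|m r] //; lia. Qed.

Variable r : 'I_n.
Local Notation fringe := (fringe a r).
Local Notation rooted := (rooted a r).

Record search_inv (I : {set 'I_n}) (st : state) : Prop := SearchInv {
  inv_rooted : rooted I;
  inv_seen : seen st = I :|: fringe I;
  inv_lf : lf st = #|fringe I|;
  inv_uniq : uniq (stk st);
  inv_stk : {subset stk st <= fringe I};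
  inv_fnd : fnd st -> exists2 S, rooted S & k <= #|fringe S|;
  inv_unfound : ~~ fnd st -> lf st < k }.

Lemma inv_init w : search_inv set0 (search_init r w).
Proof.
split=> //=; rewrite ?fringe0 ?set0U ?cards1 //.
- exact: rooted0.
- by move=> v; rewrite !inE.
- by move=> k1; exists set0; [exact: rooted0|rewrite fringe0 cards1].
- by rewrite -ltnNge.
Qed.

Lemma inv_expand I st u q w' : search_inv I st -> stk st = u :: q ->
  search_inv (u |: I) (expand u q st w').
Proof.
move=> [cI seenE lfE us sub f nf] E.
have uF : u \in fringe I by apply: sub; rewrite E mem_head.
have [uq qq] : u \notin q /\ uniq q by move: us; rewrite E /= => /andP[].
have qF v : v \in q -> v \in fringe I by move=> vq; apply: sub; rewrite E inE vq orbT.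
have lfE' : (lf st).-1 + size (news a u (seen st)) = #|fringe (u |: I)|.
  by rewrite card_fringe_expand // seenE lfE.
split; rewrite /= ?lfE' //.
- exact: rooted_expand.
- by rewrite seen_expand // seenE.
- rewrite cat_uniq news_uniq qq andbT; apply/hasPn=> v vq.
  by rewrite mem_news seenE in_setU qF // orbT andbF.
- move=> v; rewrite mem_cat fringe_expand // -seenE in_setU in_setD1.
  case/orP=> [vn|vq]; first by rewrite orbC inE vn.
  by rewrite qF // andbT; case: eqVneq vq => // ->; rewrite (negPf uq).
- by case/orP => [/f //|le]; exists (u |: I) => //; apply: rooted_expand.
- by rewrite negb_or -ltnNge => /andP[].
Qed.

Lemma inv_skip I st u q w' : search_inv I st -> stk st = u :: q ->
  search_inv I (skip q st w').
Proof.
move=> [cI seenE lfE us sub f nf] E; split=> //=.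
  by move: us; rewrite E => /andP[].
by move=> v vq; apply: sub; rewrite E inE vq orbT.
Qed.

Lemma inv_iter m w : exists I, search_inv I (iter m search_step (search_init r w)).
Proof.
elim: m => [|m [I inv]]; first by exists set0; apply: inv_init.
rewrite iterS /search_step; case E: (stk _) => [|u q]; first by exists I.
by case: ifP => _; [exists (u |: I); apply: inv_expand|exists I; apply: inv_skip E].
Qed.

Lemma search_sound w : fnd (search_end r w) ->
  exists2 S, rooted S & k <= #|fringe S|.
Proof. by have [I /inv_fnd] := inv_iter n w. Qed.

Lemma search_reach w v : #|seen (search_end r w)| = n -> connect a r v.
Proof.
have [I [cI -> _ _ _ _ _]] := inv_iter n w => full.
have sIX : I \subset [set v | connect a r v].
  apply: cI => [_|x y _]; rewrite !inE ?connect0 // => rx _ xy.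
  exact: connect_trans rx (connect1 xy).
have : v \in I :|: fringe I.
  by have /eqP-> : I :|: fringe I == setT by rewrite eqEcard subsetT cardsT card_ord full leqnn.
rewrite in_setU => /orP[/(subsetP sIX)|/fringeP[_ [->|[x /(subsetP sIX) + xv]]]].
- by rewrite inE.
- exact: connect0.
- by rewrite inE => rx; apply: connect_trans rx (connect1 xv).
Qed.

Lemma search_complete_reach : (forall v, connect a r v) ->
  #|seen (search_end r K)| = n.
Proof.
move=> reach.
have all_bits m : exists I, let st := iter m search_step (search_init r K) in
    [/\ search_inv I st, wd st = K & {subset fringe I <= stk st}].
  elim: m => [|m [I [inv wE sub]]].
    by exists set0; split=> //=; [exact: inv_init|move=> v; rewrite fringe0 !inE].
  rewrite iterS /search_step; case E: (stk _) => [|u q]; first by exists I; split=> //; rewrite E -E.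
  have -> : (if d (iter m search_step (search_init r K)) == 1 then
       (true, wd (iter m search_step (search_init r K)))
     else next_bit K (wd (iter m search_step (search_init r K)))) = (true, K).
    by rewrite wE next_bit_full if_same.
  exists (u |: I); split=> //; first exact: inv_expand.
  have uF : u \in fringe I by apply: (inv_stk inv); rewrite E mem_head.
  move=> v; rewrite /= mem_cat (inv_seen inv) fringe_expand // in_setU in_setD1.
  case/orP=> [/andP[vu /sub]|]; last by rewrite inE => ->.
  by rewrite E inE (negPf vu) /= => ->; rewrite orbT.
have [I [[cI seenE _ _ _ _ _] _ sub]] := all_bits n; rewrite -/(search_end r K) in seenE sub.
have nil : stk (search_end r K) = [::].
  by rewrite /search_end -[n in iter n](mass_init r K) stk_iter_mass.
rewrite nil in sub; rewrite seenE.
have noF v : v \in fringe I = false by apply/negP => /sub.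
suff -> : I :|: fringe I = setT by rewrite cardsT card_ord.
apply/setP=> v; rewrite in_setT.
have closed x p : x \in I :|: fringe I -> path a x p -> last x p \in I :|: fringe I.
  elim: p x => //= y p IH x xI /andP[xy]; apply: IH.
  by move: xI; rewrite in_setU noF orbF => xI; apply: out_seen xy.
by case/connectP: (reach v) => p pp ->; apply: closed pp; apply: root_seen.
Qed.

Record solution (I : {set 'I_n}) (q : seq 'I_n) (S : {set 'I_n}) : Prop := Solution {
  sol_sub : I \subset S;
  sol_rooted : rooted S;
  sol_leaves : k <= #|fringe S|;
  sol_stk : forall v, v \in S -> v \in fringe I -> v \in q }.

Definition set_wd st w := State (stk st) (seen st) (lf st) (d st) w (fnd st).

Lemma solution_expand I st u q w' S : search_inv I st -> stk st = u :: q ->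
  solution I (stk st) S -> u \in S -> solution (u |: I) (stk (expand u q st w')) S.
Proof.
move=> inv E [sIS cS lS qS] uS.
have uF : u \in fringe I by apply: (inv_stk inv); rewrite E mem_head.
split=> //; first by rewrite subUset sub1set uS.
move=> v vS; rewrite /= mem_cat (inv_seen inv) fringe_expand // in_setU in_setD1.
case/orP=> [/andP[vu /(qS v vS)]|]; last by rewrite inE => ->.
by rewrite E inE (negPf vu) /= => ->; rewrite orbT.
Qed.

(* When [u] cannot be a leaf and its expansion pushes at most one vertex, that
   vertex cannot be a leaf either, for otherwise [u] could be one instead. *)
Lemma solution_forced I st u q w' S : search_inv I st -> stk st = u :: q ->
  (forall S', solution I (stk st) S' -> u \in S') ->
  size (news a u (seen st)) <= 1 ->
  solution (u |: I) (stk (expand u q st w')) S ->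
  exists2 v, v \in news a u (seen st) & v \in S.
Proof.
move=> inv E allu n1 [sIS cS lS qS].
have uF : u \in fringe I by apply: (inv_stk inv); rewrite E mem_head.
have uS : u \in S by apply: (subsetP sIS); rewrite setU11.
case: (boolP (has [in S] (news a u (seen st)))) => [/hasP//|/hasPn out].
have sIS' : I \subset S by apply: subset_trans sIS; rewrite subsetU1.
move: n1 out; rewrite (inv_seen inv) => n1 out.
have [cS' leS'] := rooted_exchange (inv_rooted inv) cS sIS' uF uS out n1.
suff : u \in S :\ u by rewrite !inE eqxx.
apply: allu; split=> //; last 2 first.
- exact: leq_trans leS'.
- move=> v; rewrite in_setD1 => /andP[vu vS] vF.
  have := qS v vS; rewrite /= mem_cat E in_cons (negPf vu) /= fringe_expand // in_setU in_setD1 vu vF.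
  by case/(_ isT)/orP => //; rewrite (inv_seen inv) => /out; rewrite vS.
rewrite subsetD1; apply/andP; split; last by case/fringeP: uF.
by apply: subset_trans sIS; rewrite subsetU1.
Qed.

End Search.

Lemma rootedP n (a : rel 'I_n) r (S : {set 'I_n}) :
  reflect (rooted a r S) [forall X : {set 'I_n}, ((r \in S) ==> (r \in X)) ==>
    [forall x in S :&: X, forall y in S, a x y ==> (y \in X)] ==> (S \subset X)].
Proof.
apply: (iffP forallP) => [H X rX clX|cS X].
  have /implyP/(_ (introT implyP rX))/implyP := H X; apply.
  apply/forall_inP=> x; rewrite in_setI => /andP[xS xX].
  by apply/forall_inP=> y yS; apply/implyP; apply: clX.
apply/implyP=> /implyP rX; apply/implyP=> clX; apply: cS => // x y xS xX yS xy.
have xSX : x \in S :&: X by rewrite in_setI xS.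
by move/forall_inP: clX => /(_ x xSX)/forall_inP/(_ y yS)/implyP/(_ xy).
Qed.

Lemma solution_dec n (a : rel 'I_n) k r I q u :
  (forall S, solution a k r I q S -> u \in S) \/
  (exists2 S, solution a k r I q S & u \notin S).
Proof.
pose rootedb (S : {set 'I_n}) := [forall X : {set 'I_n}, ((r \in S) ==> (r \in X)) ==>
    [forall x in S :&: X, forall y in S, a x y ==> (y \in X)] ==> (S \subset X)].
pose solb (S : {set 'I_n}) := [&& I \subset S, rootedb S, k <= #|fringe a r S| &
   [forall v in S, (v \in fringe a r I) ==> (v \in q)]].
have solP S : reflect (solution a k r I q S) (solb S).
  apply: (iffP and4P) => [[sIS /rootedP cS lS /forall_inP qS]|[sIS cS lS qS]].
    by split=> // v /qS /implyP.
  split=> //; first exact/rootedP.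
  by apply/forall_inP=> v vS; apply/implyP; apply: qS.
case: (boolP [exists S : {set 'I_n}, solb S && (u \notin S)]) => [/existsP[S /andP[/solP sS uS]]|].
  by right; exists S.
rewrite negb_exists => /forallP no; left=> S /solP sS.
by have := no S; rewrite sS negbK.
Qed.

Lemma search_complete_bits n (a : rel 'I_n) k L r m st I :
  search_inv a k r I st -> mass st <= m ->
  (exists S, solution a k r I (stk st) S) ->
  (d st == 1 -> exists u q, stk st = u :: q /\
     forall S, solution a k r I (stk st) S -> u \in S) ->
  exists bs, size bs <= 2 * k + size (stk st) - (2 * lf st + (d st == 1)) /\
    (size bs <= L -> fnd (iter m (search_step a k (2 ^ L)) (set_wd st (frac L bs)))).
Proof.
elim: m st I => [|m IH] st I inv lem [S sol] forced;
  (case: (boolP (fnd st)) => [f|nf]; first by exists [::]; split=> // _; apply: fnd_iter);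
  have ltk := inv_unfound inv nf; (case E: (stk st) => [|u q];
    [exfalso | try by move: lem; rewrite /mass E]).
1,2: have SI : S = I.
1,3: apply/eqP; rewrite eqEsubset (sol_sub sol) andbT; apply: (sol_rooted sol) => [rS|x y xS xI yS xy].
1,3: have := root_seen a r I; rewrite in_setU => /orP[//|/(sol_stk sol rS)]; by rewrite E.
1,2: have := out_seen r xI xy; rewrite in_setU => /orP[//|/(sol_stk sol yS)]; by rewrite E.
1,2: by have := sol_leaves sol; rewrite SI -(inv_lf inv) leqNgt ltk.
have step b w' bs : (if d st == 1 then (true, frac L bs) else next_bit (2 ^ L) (frac L bs)) = (b, w') ->
    iter m.+1 (search_step a k (2 ^ L)) (set_wd st (frac L bs)) =
    iter m (search_step a k (2 ^ L)) (if b then expand a k u q st w' else skip q st w').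
  by rewrite iterSr /search_step /= E => ->.
have exp : (forall S, solution a k r I (stk st) S -> u \in S) ->
    let nw := news a u (seen st) in
    0 < size nw /\ exists bs,
      size bs <= 2 * k + size (nw ++ q) - (2 * ((lf st).-1 + size nw) + (size nw == 1)) /\
      (size bs <= L -> fnd (iter m (search_step a k (2 ^ L)) (expand a k u q st (frac L bs)))).
  move=> allu nw.
  have sol' := solution_expand 0 inv E sol (allu S sol).
  have forced' S' := @solution_forced _ a k r I st u q 0 S' inv E allu.
  split.
    rewrite lt0n; apply/negP=> /eqP nw0; have [] := forced' S _ sol'; first by rewrite -/nw nw0.
    by move=> v; rewrite -/nw (size0nil nw0).
  case: (IH (expand a k u q st 0) (u |: I)) => [||||bs f]; last by exists bs.
  - exact: inv_expand.
  - by move: lem; rewrite (mass_expand a k 0 E).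
  - by exists S.
  - rewrite /= -/nw; case nwE: nw => [|v [|]] //= _; exists v, q; split=> // S' sol1.
    have sol2 : solution a k r (u |: I) (stk (expand a k u q st 0)) S' by rewrite /= -/nw nwE.
    have n1 : size (news a u (seen st)) <= 1 by rewrite -/nw nwE.
    by have [v'] := forced' S' n1 sol2; rewrite -/nw nwE inE => /eqP->.
have lf0 : 0 < lf st.
  by rewrite (inv_lf inv) card_gt0; apply/set0Pn; exists u; apply: (inv_stk inv); rewrite E mem_head.
case: (boolP (d st == 1)) => [d1|d1].
  have [u' [q' [E' allu]]] := forced d1; move: E'; rewrite E => -[uE qE]; rewrite -{}uE in allu.
  have [nw0 [bs [szbs f]]] := exp allu; exists bs; split.
    by move: szbs nw0; rewrite size_cat /=; case: eqVneq => /=; lia.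
  by rewrite (step true (frac L bs)) ?d1.
have bit b bs : d st != 1 -> size bs < L ->
    (if d st == 1 then (true, frac L (b :: bs)) else next_bit (2 ^ L) (frac L (b :: bs)))
    = (b, frac L bs).
  by move=> /negPf-> lt; rewrite next_bit_frac.
case: (solution_dec a k r I (stk st) u) => [allu|[S' sol' uS']].
  have [nw0 [bs [szbs f]]] := exp allu; exists (true :: bs); split.
    by move: szbs nw0; rewrite size_cat /=; case: eqVneq => /=; lia.
  by move=> lt; rewrite (step _ _ _ (bit _ _ _ _)) //; apply/f/ltnW.
case: (IH (skip q st 0) I).
- exact: inv_skip E.
- by move: lem; rewrite /mass E /=; lia.
- exists S'; case: sol' => sIS cS lS qS; split=> // v vS vF.
  have := qS v vS vF; rewrite E inE => /orP[/eqP vu|//].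
  by rewrite vu (negPf uS') in vS.
- by [].
move=> bs [szbs f]; exists (false :: bs); split.
  by move: szbs => /=; lia.
by move=> lt; rewrite (step _ _ _ (bit _ _ _ _)) //; apply/f/ltnW.
Qed.

Lemma search_complete n (a : rel 'I_n) k r S : rooted a r S ->
  k <= #|fringe a r S| -> 0 < k ->
  exists2 w, w < 2 ^ (2 * k) & fnd (search_end a k (2 ^ (2 * k)) r w).
Proof.
move=> cS kS k0; have sol : solution a k r set0 [:: r] S.
  by split; rewrite ?sub0set // => v vS; rewrite fringe0 !inE.
have [|||bs /= [szbs f]] := @search_complete_bits _ a k (2 * k) r n _ _ (inv_init a k r 0).
- by rewrite mass_init.
- by exists S.
- by [].
exists (frac (2 * k) bs); first by apply: frac_lt; lia.
by apply: f; lia.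
Qed.

Lemma search_correct n (a : rel 'I_n) k : 0 < k ->
  has_k_leaf_out_branching a k <->
  exists r, (exists2 w, w <= 2 ^ (2 * k) &
               #|seen (search_end a k (2 ^ (2 * k)) r w)| = n) /\
            (exists2 w, w <= 2 ^ (2 * k) & fnd (search_end a k (2 ^ (2 * k)) r w)).
Proof.
move=> k0; split=> [/has_leaves_rooted[r [reach [S cS kS]]]|].
  exists r; split; first by exists (2 ^ (2 * k)) => //; apply: search_complete_reach.
  by have [w lt f] := search_complete cS kS k0; exists w => //; apply: ltnW.
case=> r [[w _ full] [w' _ /search_sound[S cS kS]]].
by apply: rooted_has_leaves cS kS => v; apply: search_reach full.
Qed.

(** * Structured programs on the RAM *)

(* [While r c] loops as long as register [r] is nonzero.  Unconditional jumps
   are compiled to [IJz 3 _] after clearing register 3, which programs must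
   therefore not use. *)
Inductive cmd : Type :=
| Blk of seq instr
| Seq of cmd & cmd
| If of nat & cmd & cmd
| While of nat & cmd.

Fixpoint compile (c : cmd) (pc : nat) : seq instr :=
  match c with
  | Blk b => b
  | Seq c1 c2 => let p1 := compile c1 pc in p1 ++ compile c2 (pc + size p1)
  | If r c1 c2 =>
    let p1 := compile c1 pc.+1 in
    let p2 := compile c2 (pc + size p1 + 3) in
    IJz r (pc + size p1 + 3) :: p1 ++
      IConst 3 0 :: IJz 3 (pc + size p1 + 3 + size p2) :: p2
  | While r c =>
    let p := compile c pc.+1 in
    IJz r (pc + size p + 3) :: p ++ [:: IConst 3 0; IJz 3 pc]
  end.

Definition straight (i : instr) : bool :=
  match i with IJz _ _ | IHalt => false | _ => true end.

Fixpoint run_block (b : seq instr) (m : memory) : memory :=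
  if b is i :: b' then run_block b' (step i 0 m).2 else m.

Inductive eval : cmd -> memory -> nat -> memory -> Prop :=
| EvalBlk b m : all straight b -> eval (Blk b) m (size b) (run_block b m)
| EvalSeq c1 c2 m t1 m1 t2 m2 : eval c1 m t1 m1 -> eval c2 m1 t2 m2 ->
    eval (Seq c1 c2) m (t1 + t2) m2
| EvalIfT r c1 c2 m t m1 : m r != 0 -> eval c1 m t m1 ->
    eval (If r c1 c2) m t.+3 (upd m1 3 0)
| EvalIfF r c1 c2 m t m1 : m r = 0 -> eval c2 m t m1 ->
    eval (If r c1 c2) m t.+1 m1
| EvalWhile0 r c m : m r = 0 -> eval (While r c) m 1 m
| EvalWhile r c m t1 m1 t2 m2 : m r != 0 -> eval c m t1 m1 ->
    eval (While r c) (upd m1 3 0) t2 m2 -> eval (While r c) m (t1 + t2).+3 m2.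

Lemma exec_step (P : seq instr) t pc m i :
  nth IHalt P pc = i -> (if i is IHalt then false else true) ->
  exec P t.+1 pc m = exec P t (step i pc m).1 (step i pc m).2.
Proof. by move=> /= ->; case: i => //=. Qed.

Lemma exec_past (P : seq instr) t pc m : size P <= pc -> exec P t pc m = Some m.
Proof. by move=> le; case: t => [|t] /=; rewrite nth_default. Qed.

Arguments exec : simpl never.

Definition code_at (P : seq instr) (pc : nat) (p : seq instr) : Prop :=
  forall i, i < size p -> nth IHalt P (pc + i) = nth IHalt p i.

Lemma code_at_cat P pc p1 p2 : code_at P pc (p1 ++ p2) ->
  code_at P pc p1 /\ code_at P (pc + size p1) p2.
Proof.
move=> H; split=> i lt.
  by rewrite H ?nth_cat ?lt // size_cat ltn_addr.
by rewrite -addnA H ?size_cat ?ltn_add2l // nth_cat ltnNge leq_addr /= addKn.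
Qed.

Lemma code_at_cons P pc i p : code_at P pc (i :: p) ->
  nth IHalt P pc = i /\ code_at P pc.+1 p.
Proof.
move=> H; split; first by have := H 0 isT; rewrite addn0.
by move=> j lt; have := H j.+1; rewrite addSnnS; apply.
Qed.

Lemma exec_block P pc b t m : all straight b -> code_at P pc b ->
  exec P (size b + t) pc m = exec P t (pc + size b) (run_block b m).
Proof.
elim: b pc m => [|i b IH] pc m; first by rewrite addn0.
move=> /= /andP[si sb] /code_at_cons[Pi Pb]; rewrite addSn (exec_step _ _ Pi); last by case: (i) si.
rewrite -addSnnS -IH //; by case: (i) si.
Qed.

Lemma eval_exec c m t m' : eval c m t m' -> forall P pc f,
  code_at P pc (compile c pc) ->
  exec P (t + f) pc m = exec P f (pc + size (compile c pc)) m'.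
Proof.
elim=> {c m t m'} /=.
- by move=> b m sb P pc f; apply: exec_block.
- move=> c1 c2 m t1 m1 t2 m2 _ IH1 _ IH2 P pc f /code_at_cat[at1 at2].
  by rewrite -addnA IH1 // IH2 // size_cat addnA.
- move=> r c1 c2 m t m1 mr _ IH P pc f.
  case/code_at_cons=> Pjz /code_at_cat[at1]; case/code_at_cons=> Pz /code_at_cons[Pj _].
  rewrite !addSn (exec_step _ _ Pjz) //= (negPf mr) -!addnS IH //.
  rewrite (exec_step _ _ Pz) // (exec_step _ _ Pj) //= /upd /=; congr exec.
  by rewrite size_cat /=; lia.
- move=> r c1 c2 m t m1 mr _ IH P pc f.
  case/code_at_cons=> Pjz /code_at_cat[_] /code_at_cons[_] /code_at_cons[_].
  set q := compile c2 _ => at2.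
  rewrite addSn (exec_step _ _ Pjz) //= mr eqxx IH; first by congr exec; rewrite size_cat /= -/q; lia.
  by move: at2; rewrite (_ : _.+2 = pc + size (compile c1 pc.+1) + 3) //; lia.
- move=> r c m mr P pc f /code_at_cons[Pjz _].
  by rewrite add1n (exec_step _ _ Pjz) //= mr eqxx; congr exec; rewrite size_cat /=; lia.
- move=> r c m t1 m1 t2 m2 mr _ IH1 _ IH2 P pc f at_all.
  move: (at_all) => /code_at_cons[Pjz /code_at_cat[at1]]; case/code_at_cons=> Pz /code_at_cons[Pj _].
  rewrite !addSn (exec_step _ _ Pjz) //= (negPf mr).
  rewrite (_ : (t1 + t2 + f).+2 = t1 + (t2 + f).+2) ?IH1 //; last by lia.
  rewrite (exec_step _ _ Pz) // (exec_step _ _ Pj) //=.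
  by rewrite IH2.
Qed.

Lemma compile_exec c m t m' T : eval c m t m' -> t <= T ->
  exec (compile c 0) T 0 m = Some m'.
Proof.
move=> ev le; rewrite -(subnKC le) (eval_exec ev) //.
by rewrite exec_past.
Qed.

Definition ok (c : cmd) (m : memory) (T : nat) (Q : memory -> Prop) : Prop :=
  exists t m', [/\ t <= T, eval c m t m' & Q m'].

Lemma ok_weaken c m T T' (Q Q' : memory -> Prop) : ok c m T Q -> T <= T' ->
  (forall m', Q m' -> Q' m') -> ok c m T' Q'.
Proof.
by move=> [t [m' [le ev q]]] leT H; exists t, m'; split=> //; [apply: leq_trans leT|apply: H].
Qed.

Definition okb (b : seq instr) (m : memory) (Q : memory -> Prop) : Prop := Q (run_block b m).

Lemma ok_block b m T Q : all straight b -> size b <= T -> okb b m Q -> ok (Blk b) m T Q.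
Proof. by move=> sb le q; exists (size b), (run_block b m); split=> //; constructor. Qed.

Lemma okb_nil m (Q : memory -> Prop) : Q m -> okb [::] m Q.
Proof. by []. Qed.

Lemma okb_const r v b m Q : okb b (upd m r v) Q -> okb (IConst r v :: b) m Q.
Proof. by []. Qed.

Lemma okb_add r x y vx vy b m Q : m x = vx -> m y = vy ->
  okb b (upd m r (vx + vy)) Q -> okb (IAdd r x y :: b) m Q.
Proof. by move=> <- <-. Qed.

Lemma okb_sub r x y vx vy b m Q : m x = vx -> m y = vy ->
  okb b (upd m r (vx - vy)) Q -> okb (ISub r x y :: b) m Q.
Proof. by move=> <- <-. Qed.

Lemma okb_load r x p v b m Q : m x = p -> m p = v ->
  okb b (upd m r v) Q -> okb (ILoad r x :: b) m Q.
Proof. by move=> <- <-. Qed.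

Lemma okb_store x r p v b m Q : m x = p -> m r = v ->
  okb b (upd m p v) Q -> okb (IStore x r :: b) m Q.
Proof. by move=> <- <-. Qed.

Lemma upd_eq m p v : upd m p v p = v.
Proof. by rewrite /upd eqxx. Qed.

Lemma upd_ne m p v q : (q == p) = false -> upd m p v q = m q.
Proof. by rewrite /upd => ->. Qed.

Lemma neq_eqF (p q : nat) : p <> q -> (p == q) = false.
Proof. by move/eqP/negbTE. Qed.

Lemma ok_seq c1 c2 m T1 T2 T Q :
  ok c1 m T1 (fun m1 => ok c2 m1 T2 Q) -> T1 + T2 <= T -> ok (Seq c1 c2) m T Q.
Proof.
move=> [t1 [m1 [le1 ev1 [t2 [m2 [le2 ev2 q]]]]]] le; exists (t1 + t2), m2; split=> //.
  by lia.
exact: EvalSeq ev1 ev2.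
Qed.

Lemma ok_if r c1 c2 m T T' Q :
  (m r != 0 -> ok c1 m T (fun m' => Q (upd m' 3 0))) -> (m r = 0 -> ok c2 m T Q) ->
  T + 3 <= T' -> ok (If r c1 c2) m T' Q.
Proof.
move=> H1 H2 le; case: (eqVneq (m r) 0) => mr.
  have [t [m' [let' ev q]]] := H2 mr; exists t.+1, m'; split=> //; [lia|exact: EvalIfF].
have [t [m' [let' ev q]]] := H1 mr; exists t.+3, (upd m' 3 0); split=> //; [lia|exact: EvalIfT].
Qed.

Lemma ok_ifv r v c1 c2 m T T' Q : m r = v ->
  (v != 0 -> ok c1 m T (fun m' => Q (upd m' 3 0))) -> (v = 0 -> ok c2 m T Q) ->
  T + 3 <= T' -> ok (If r c1 c2) m T' Q.
Proof. by move=> <-; apply: ok_if. Qed.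

Lemma ok_while r c T (Inv : nat -> memory -> Prop) :
  (forall N m, Inv N m -> m r != 0 ->
     exists2 N', N = N'.+1 & ok c m T (fun m' => Inv N' (upd m' 3 0))) ->
  forall N m, Inv N m ->
    ok (While r c) m (N * (T + 3) + 1) (fun m' => m' r = 0 /\ exists N', Inv N' m').
Proof.
move=> step; elim/ltn_ind=> N IH m inv; case: (eqVneq (m r) 0) => mr.
  by exists 1, m; split; [lia|exact: EvalWhile0|split=> //; exists N].
have [N' NE [t [m1 [le ev inv1]]]] := step N m inv mr.
have [|t2 [m2 [le2 ev2 q2]]] := IH N' _ _ inv1; first by rewrite NE.
exists (t + t2).+3, m2; split=> //; last exact: EvalWhile ev ev2.
by rewrite NE mulSn; lia.
Qed.

Definition For (r : nat) (c : cmd) : cmd := While r (Seq (Blk [:: ISub r r 4]) c).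

Lemma ok_for r c T (Inv : nat -> memory -> Prop) :
  (forall N m, Inv N m -> m r = N /\ m 4 = 1) ->
  (forall N m, Inv N.+1 m -> ok c (upd m r N) T (fun m' => Inv N (upd m' 3 0))) ->
  forall N T' m, Inv N m -> N * (T + 4) + 1 <= T' -> ok (For r c) m T' (Inv 0).
Proof.
move=> cnt step N T' m inv le.
have body N0 m0 : Inv N0 m0 -> m0 r != 0 -> exists2 N', N0 = N'.+1 &
    ok (Seq (Blk [:: ISub r r 4]) c) m0 (T + 1) (fun m' => Inv N' (upd m' 3 0)).
  move=> inv0; have [mr m4] := cnt _ _ inv0; rewrite mr.
  case: N0 inv0 mr => // N0 inv0 mr _; exists N0 => //.
  apply: (@ok_seq _ _ _ 1 T); last by lia.
  apply: ok_block; rewrite // /okb /= mr m4 subn1 /=; exact: step.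
apply: (ok_weaken (ok_while body inv)); first by lia.
move=> m' [m'r [N' inv']]; have [] := cnt _ _ inv'; rewrite m'r => E _.
by rewrite -E in inv'.
Qed.

(** * The search program *)

(* Registers: 2 = bit source w, 4 = the constant 1, 5/6/7 = base addresses of
   the adjacency matrix, the seen marks and the stack, 8 = K, 9 = answer,
   10 = root, 11 = reach flag, 12 = found flag, 13 = bit string, 15 = stack size,
   16 = fringe size, 17 = seen count, 18 = d, 19 = current vertex,
   20 = current bit, 21 = row address, 14 and 22 = loop counters,
   23 and 24 = temporaries. *)
Definition next_bit_cmd : cmd :=
  Seq (Blk [:: IAdd 2 2 2; ISub 23 8 2])
      (If 23 (Blk [:: IConst 20 0]) (Blk [:: IConst 20 1; ISub 2 2 8])).

Definition push_cmd : cmd :=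
  Seq (Blk [:: IAdd 23 21 22; ILoad 23 23])
  (If 23
     (Seq (Blk [:: IAdd 24 6 22; ILoad 23 24])
        (If 23 (Blk [::])
           (Blk [:: IStore 24 4; IAdd 23 7 15; IStore 23 22; IAdd 15 15 4;
                    IAdd 16 16 4; IAdd 17 17 4; IAdd 18 18 4])))
     (Blk [::])).

Definition check_found_cmd : cmd :=
  Seq (Blk [:: ISub 23 1 16]) (If 23 (Blk [::]) (Blk [:: IConst 12 1])).

Definition expand_cmd : cmd :=
  Seq (Blk [:: ISub 16 16 4; IConst 18 0; IAdd 21 5 18; IAdd 14 19 18])
  (Seq (For 14 (Blk [:: IAdd 21 21 0]))
  (Seq (Blk [:: IAdd 22 0 18])
  (Seq (For 22 push_cmd) check_found_cmd))).

Definition search_step_cmd : cmd :=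
  Seq (Blk [:: ISub 15 15 4; IAdd 23 7 15; ILoad 19 23; ISub 23 18 4;
               ISub 24 4 18; IAdd 23 23 24; IConst 20 1])
  (Seq (If 23 next_bit_cmd (Blk [::]))
       (If 20 expand_cmd (Blk [:: IConst 18 0]))).

Definition search_cmd : cmd :=
  Seq (Blk [:: IConst 18 0; IAdd 2 13 18; IAdd 14 0 18])
  (Seq (For 14 (Blk [:: IAdd 23 6 14; IStore 23 18]))
  (Seq (Blk [:: IAdd 23 6 10; IStore 23 4; IStore 7 10; IConst 15 1;
                IConst 16 1; IConst 17 1])
  (Seq check_found_cmd
  (Seq (While 15 search_step_cmd)
  (Seq (Blk [:: ISub 23 0 17]) (If 23 (Blk [::]) (Blk [:: IConst 11 1]))))))).

Definition main_cmd : cmd :=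
  Seq (Blk [:: IConst 9 0; IConst 18 0; IAdd 10 0 18])
  (Seq (For 10
    (Seq (Blk [:: IConst 11 0; IConst 12 0; IAdd 13 8 4])
    (Seq (For 13 search_cmd)
         (If 11 (If 12 (Blk [:: IConst 9 1]) (Blk [::])) (Blk [::])))))
  (Blk [:: IConst 18 0; IAdd 0 9 18])).

Ltac rd :=
  repeat first [rewrite upd_eq
               |rewrite upd_ne; [|first [reflexivity | apply: neq_eqF; lia]]];
  first [eassumption | reflexivity].

Ltac sym_run :=
  repeat first [apply: okb_const | eapply okb_add; [rd|rd|] | eapply okb_sub; [rd|rd|]
               |eapply okb_load; [rd|rd|] | eapply okb_store; [rd|rd|]];
  apply: okb_nil.

Ltac blk := apply: ok_block; [by []|by []|]; sym_run.

Definition keeps (A : pred nat) (m m' : memory) : Prop := forall p, A p -> m' p = m p.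

Lemma keeps_trans A m1 m2 m3 : keeps A m1 m2 -> keeps A m2 m3 -> keeps A m1 m3.
Proof. by move=> k12 k23 p Ap; rewrite k23 // k12. Qed.

Lemma sub_keeps (A B : pred nat) m m' : keeps A m m' -> subpred B A -> keeps B m m'.
Proof. by move=> k12 sBA p /sBA; apply: k12. Qed.

Definition outside (ws : seq nat) : pred nat := fun p => p \notin ws.

Lemma next_bit_ok K w m : m 2 = w -> m 8 = K ->
  ok next_bit_cmd m 7 (fun m' => [/\ m' 2 = (next_bit K w).2,
    m' 20 = (next_bit K w).1 & keeps (outside [:: 2; 3; 20; 23]) m m']).
Proof.
move=> m2 m8; apply: (@ok_seq _ _ _ 2 5) => //; blk.
apply: (@ok_ifv _ (K - (w + w)) _ _ _ 2); [by rd| | |by []].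
  move=> c; blk; rewrite /next_bit leqNgt -subn_gt0 lt0n c mul0n subn0.
  by split; [rd|rd|move=> p; rewrite /outside !inE => hp; rd].
move=> c; blk; rewrite /next_bit (_ : _ <= _) ?mul1n; last by lia.
by split; [rd|rd|move=> p; rewrite /outside !inE => hp; rd].
Qed.

Section Correctness.
Variables (n : nat) (a : rel 'I_n) (k K M Sb T : nat).
Hypotheses (M_ge : 32 <= M) (Sb_ge : M + n * n <= Sb) (T_ge : Sb + n <= T).

Lemma Sb_ge32 : 32 <= Sb.
Proof. exact: leq_trans M_ge (leq_trans (leq_addr _ _) Sb_ge). Qed.

Record ctx (m : memory) : Prop := Ctx {
  ctx_n : m 0 = n; ctx_k : m 1 = k; ctx_1 : m 4 = 1; ctx_M : m 5 = M;
  ctx_S : m 6 = Sb; ctx_T : m 7 = T; ctx_K : m 8 = K;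
  ctx_a : forall u v : 'I_n, m (M + (u * n + v)) = a u v }.

Definition stable : pred nat :=
  fun p => (p < Sb) && (p \notin [:: 2; 3; 12; 14; 15; 16; 17; 18; 19; 20; 21; 22; 23; 24]).

Lemma cell_lt (u v : 'I_n) : u * n + v < n * n.
Proof. by have := ltn_ord u; have := ltn_ord v; nia. Qed.

Lemma ctx_keeps (A : pred nat) m m' : ctx m -> keeps A m m' ->
  (forall p, p \in [:: 0; 1; 4; 5; 6; 7; 8] -> A p) -> (forall p, 32 <= p < Sb -> A p) -> ctx m'.
Proof.
move=> [h0 h1 h4 h5 h6 h7 h8 ha] kA As Ah.
split; rewrite ?kA //; try by apply: (As); rewrite !inE.
move=> u v; rewrite kA //; apply: Ah; have := cell_lt u v; lia.
Qed.

Record rep (f0 : bool) (st : state n) (m : memory) : Prop := Rep {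
  rep_w : m 2 = wd st;
  rep_sp : m 15 = size (stk st);
  rep_stk : forall i, i < size (stk st) -> m (T + i) = nth 0 (map val (rev (stk st))) i;
  rep_seen : forall v : 'I_n, m (Sb + v) = (v \in seen st);
  rep_lf : m 16 = lf st;
  rep_tot : m 17 = #|seen st|;
  rep_d : m 18 = d st;
  rep_fnd : m 12 = f0 || fnd st }.

Lemma rep_keeps f0 st m m' : rep f0 st m ->
  keeps (outside [:: 3; 14; 19; 20; 21; 22; 23; 24]) m m' -> rep f0 st m'.
Proof.
move=> [h1 h2 h3 h4 h5 h6 h7 h8] km.
split=> [|||v|||| ]; rewrite ?km //.
- by move=> i lt; rewrite km ?h3 // /outside !inE; lia.
- by rewrite /outside !inE; lia.
Qed.

Lemma rep_push f0 s X l dd w f m m' (v : 'I_n) : rep f0 (State s X l dd w f) m ->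
  v \notin X ->
  m' (Sb + v) = 1 -> m' (T + size s) = v -> m' 15 = size s + 1 ->
  m' 16 = m 16 + 1 -> m' 17 = m 17 + 1 -> m' 18 = m 18 + 1 ->
  keeps (outside [:: 3; 15; 16; 17; 18; 22; 23; 24; Sb + v; T + size s]) m m' ->
  rep f0 (State (v :: s) (v |: X) l.+1 dd.+1 w f) m'.
Proof.
move=> [/= h1 h2 h3 h4 h5 h6 h7 h8] vX e1 e2 e3 e4 e5 e6 km.
have ltv := ltn_ord v.
split=> /=.
- by rewrite km // /outside !inE; lia.
- by rewrite e3 addn1.
- move=> i; rewrite ltnS => lt; rewrite rev_cons map_rcons nth_rcons size_map size_rev.
  case: (ltngtP i (size s)) lt => // [lt _|-> //].
  by rewrite km ?h3 // /outside !inE; lia.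
- move=> u; rewrite in_setU1; case: (eqVneq u v) => [->|uv]; first by rewrite e1.
  have ltu := ltn_ord u; have neq : (u : nat) <> v by move=> /val_inj E; rewrite E eqxx in uv.
  by rewrite km ?h4 // /outside !inE; lia.
- by rewrite e4 h5 addn1.
- by rewrite e5 h6 cardsU1 vX addn1.
- by rewrite e6 h7 addn1.
- by rewrite km // /outside !inE; lia.
Qed.

Definition news_from N (u : 'I_n) (X : {set 'I_n}) : seq 'I_n :=
  [seq v <- drop N (enum 'I_n) | a u v && (v \notin X)].

Lemma news_from0 u X : news_from 0 u X = news a u X.
Proof. by rewrite /news_from drop0. Qed.

Lemma news_fromn u X : news_from n u X = [::].
Proof. by rewrite /news_from drop_oversize // size_enum_ord. Qed.

Lemma news_fromS (v u : 'I_n) X : news_from v u X =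
  if a u v && (v \notin X) then v :: news_from v.+1 u X else news_from v.+1 u X.
Proof.
by rewrite /news_from (drop_nth v) ?size_enum_ord // nth_ord_enum /=; case: ifP.
Qed.

Lemma news_from_notin (v u : 'I_n) X : v \notin news_from v.+1 u X.
Proof.
rewrite mem_filter; apply/negP=> /andP[_ vd].
have := drop_uniq v (enum_uniq 'I_n).
by rewrite (drop_nth v) ?size_enum_ord // nth_ord_enum /= vd.
Qed.

Definition pushed N u q X l w f : state n :=
  State (news_from N u X ++ q) (X :|: [set v in news_from N u X])
    (l + size (news_from N u X)) (size (news_from N u X)) w f.

Definition push_keep : pred nat :=
  fun p => (p < Sb) && (p \notin [:: 3; 15; 16; 17; 18; 22; 23; 24]).

Lemma push_ok f0 (u : 'I_n) q X l w f m : ctx m -> m 21 = M + u * n -> m 22 = n ->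
  rep f0 (State q X l 0 w f) m ->
  ok (For 22 push_cmd) m (n * 24 + 1) (fun m' =>
    keeps push_keep m m' /\ rep f0 (pushed 0 u q X l w f) m').
Proof.
move=> cm m21 m22 rm.
pose Inv N m' := [/\ N <= n, m' 22 = N, keeps push_keep m m' &
  rep f0 (pushed N u q X l w f) m'].
have start : Inv n m.
  split=> //; rewrite /pushed news_fromn /= addn0.
  by rewrite (_ : X :|: _ = X) //; apply/setP=> v; rewrite !inE in_nil orbF.
have Sb32 := Sb_ge32.
have ctxI N m1 : Inv N m1 -> ctx m1.
  move=> [_ _ km _]; apply: (ctx_keeps cm km) => p; rewrite /push_keep ?inE; lia.
have := @ok_for 22 push_cmd 20 Inv _ _ n (n * 24 + 1) m start.
case=> [N m1 inv|N m1 inv||t [m' [le ev [_ _ km rm']]]]; last by exists t, m'.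
- by split; [case: inv|case: (ctxI _ _ inv)].
- have c1 := ctxI _ _ inv; case: inv => ltN m22' km rm1.
  pose v := Ordinal ltN; have ltv := cell_lt u v; rewrite /= in ltv.
  have m21' : m1 21 = M + u * n by rewrite km // /push_keep !inE; lia.
  have avE : m1 (M + u * n + N) = a u v by rewrite -addnA (ctx_a c1 u v).
  have svE : m1 (Sb + N) = (v \in X).
    rewrite (rep_seen rm1 v) /= inE; congr nat_of_bool.
    rewrite [X in _ || X]inE; have := news_from_notin v u X => /= /negPf->.
    by rewrite orbF.
  have [c0 ck c4 cM cS cT cK ca] := c1.
  have sp := rep_sp rm1.
  have hA : 32 <= M + u * n + N by lia.
  have hS : 32 <= Sb + N by lia.
  have hT : 32 <= T + size (news_from N.+1 u X ++ q) by lia.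
  have nope : ~~ (a u v && (v \notin X)) -> forall m', keeps (outside [:: 3; 22; 23; 24]) m1 m' ->
      m' 22 = N -> Inv N m'.
    move=> no m' k' e; split=> //; first exact: ltnW.
    - apply: keeps_trans km _; apply: sub_keeps k' _ => p.
      by rewrite /push_keep /outside !inE; lia.
    - rewrite /pushed; have := news_fromS v u X; rewrite /= (negPf no) => ->.
      apply: rep_keeps rm1 _; apply: sub_keeps k' _ => p.
      by rewrite /outside !inE; lia.
  apply: (@ok_seq _ _ _ 2 15) => //; blk.
  apply: (@ok_ifv _ (a u v) _ _ _ 12); [by rd| | |by []].
    rewrite eqb0 negbK => uv; apply: (@ok_seq _ _ _ 2 10) => //; blk.
    apply: (@ok_ifv _ (v \in X) _ _ _ 7); [by rd| | |by []].
      rewrite eqb0 negbK => vX; blk; apply: nope; first by rewrite vX andbF.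
      - by move=> p; rewrite /outside !inE => hp; rd.
      - by rd.
    move/eqP; rewrite eqb0 => vX; blk.
    split=> [||p|].
    - exact: ltnW.
    - by rd.
    - by rewrite /push_keep !inE => hp; rewrite -km /push_keep ?inE //; rd.
    rewrite /pushed; have := news_fromS v u X; rewrite /= uv vX => -> /=.
    set s := news_from N.+1 u X in rm1 sp *.
    rewrite (_ : _ :|: [set v0 in v :: s] = v |: (X :|: [set v0 in s])); last first.
      by apply/setP=> x; rewrite !inE orbCA.
    rewrite [l + _]addnS; apply: (rep_push rm1) => /=; try by rd.
    - by rewrite in_setU (negPf vX) [_ \in [set _ | _]]inE; apply: (news_from_notin v).
    - by move=> p; rewrite /outside !inE -/s => hp; rd.
  move/eqP; rewrite eqb0 => uv; blk; apply: nope; first by rewrite (negPf uv).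
  - by move=> p; rewrite /outside !inE => hp; rd.
  - by rd.
- by lia.
Qed.

Lemma check_found_ok F (fd : bool) m : m 1 = k -> m 16 = F -> m 12 = fd ->
  ok check_found_cmd m 5 (fun m' =>
    keeps (outside [:: 3; 12; 23]) m m' /\ m' 12 = (fd || (k <= F))).
Proof.
move=> m1 m16 m12; apply: (@ok_seq _ _ _ 1 4) => //; blk.
apply: (@ok_ifv _ (k - F) _ _ _ 1); [by rd| | |by []] => c; blk.
  split; first by move=> p; rewrite /outside !inE => hp; rd.
  by rewrite leqNgt -subn_gt0 lt0n c orbF; rd.
split; first by move=> p; rewrite /outside !inE => hp; rd.
by rewrite (_ : k <= F) ?orbT; [rd|lia].
Qed.

Lemma rep_found f0 s X l dd w f b m m' : rep f0 (State s X l dd w f) m ->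
  keeps (outside [:: 3; 12; 23]) m m' -> m' 12 = (f0 || f) || b ->
  rep f0 (State s X l dd w (f || b)) m'.
Proof.
have Sb32 := Sb_ge32.
move=> [h1 h2 h3 h4 h5 h6 h7 h8] km e; split=> /=; try by rewrite km.
- by move=> i lt; rewrite km ?h3 // /outside !inE; lia.
- by move=> v; rewrite km ?h4 // /outside !inE; lia.
- by rewrite e orbA.
Qed.

Lemma expand_ok f0 (u : 'I_n) q X l dd w f m : ctx m -> m 19 = u ->
  rep f0 (State q X l dd w f) m ->
  ok expand_cmd m (n * 29 + 12) (fun m' => keeps stable m m' /\
    rep f0 (expand a k u q (State q X l dd w f) w) m').
Proof.
move=> cm m19 rm; have Sb32 := Sb_ge32; have ltu := ltn_ord u.
have [c0 ck c4 cM cS cT cK ca] := cm.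
have e16 := rep_lf rm; rewrite /= in e16.
apply: (@ok_seq _ _ _ 4 (n * 29 + 8)); [blk|by lia].
set m1 := upd _ _ _.
have k1 : keeps (outside [:: 14; 16; 18; 21]) m m1.
  by move=> p; rewrite /outside !inE => hp; rewrite /m1; rd.
have e14 : m1 14 = u by rewrite /m1 !addn0; rd.
have e21 : m1 21 = M by rewrite /m1 !addn0; rd.
have e18 : m1 18 = 0 by rewrite /m1; rd.
have e16' : m1 16 = l.-1 by rewrite /m1 -subn1; rd.
pose Inv N m' := [/\ N <= u, m' 14 = N, m' 21 = M + (u - N) * n &
  keeps (outside [:: 3; 14; 21]) m1 m'].
apply: (@ok_seq _ _ _ (n * 5 + 1) (n * 24 + 7)); last by lia.
have start : Inv u m1 by split; rewrite ?subnn ?addn0.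
have loop := @ok_for 14 (Blk [:: IAdd 21 21 0]) 1 Inv _ _ u (n * 5 + 1) m1 start.
apply: (ok_weaken (loop _ _ _)) => // [N m'|N m'||m2].
- by move=> [_ e _ k2]; split=> //; rewrite k2 // k1.
- move=> [le _ e k2]; have e0 : m' 0 = n by rewrite k2 // k1.
  blk; split=> [||//|p]; [exact: ltnW|by rd| |].
    rewrite (_ : (u - N) * n = (u - N.+1) * n + n); last by rewrite -mulSnr -subSn // subSS.
    by rewrite addnA; rd.
  by rewrite /outside !inE => hp; rewrite -k2 /outside ?inE //; rd.
- by lia.
move=> [_ _ e21' k2]; rewrite subn0 in e21'; clearbody m1.
have k12 : keeps (outside [:: 3; 14; 16; 18; 21]) m m2.
  by apply: keeps_trans (sub_keeps k1 _) (sub_keeps k2 _) => p; rewrite /outside !inE; lia.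
have c2 : ctx m2 by apply: (ctx_keeps cm k12) => p; rewrite /outside ?inE; lia.
apply: (@ok_seq _ _ _ 1 (n * 24 + 6)); last by lia.
have e18' : m2 18 = 0 by rewrite k2.
have e0' : m2 0 = n by rewrite k12.
blk; set m3 := upd _ _ _.
have k3 : keeps (outside [:: 22]) m2 m3.
  by move=> p; rewrite /outside !inE => hp; rewrite /m3; rd.
have e22 : m3 22 = n by rewrite /m3 !addn0; rd.
clearbody m3.
have k13 : keeps (outside [:: 3; 14; 16; 18; 21; 22]) m m3.
  by apply: keeps_trans (sub_keeps k12 _) (sub_keeps k3 _) => p; rewrite /outside !inE; lia.
have c3 : ctx m3 by apply: (ctx_keeps cm k13) => p; rewrite /outside ?inE; lia.
have r3 : rep f0 (State q X l.-1 0 w f) m3.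
  have [h1 h2 h3 h4 h5 h6 h7 h8] := rm; split=> /=; try by rewrite k13.
  - by move=> i lt; rewrite k13 ?h3 // /outside !inE; lia.
  - by move=> v; rewrite k13 ?h4 // /outside !inE; lia.
  - by rewrite k3 // k2.
  - by rewrite k3 // k2.
apply: (@ok_seq _ _ _ (n * 24 + 1) 5); last by lia.
have e21'' : m3 21 = M + u * n by rewrite k3.
apply: (ok_weaken (push_ok c3 e21'' e22 r3)) => // m4 [k4 r4].
have k14 : keeps (fun p => (p < Sb) && (p \notin [:: 3; 14; 15; 16; 17; 18; 21; 22; 23; 24])) m m4.
  apply: keeps_trans (sub_keeps k13 _) (sub_keeps k4 _) => p;
  by rewrite /outside /push_keep !inE; lia.
apply: (ok_weaken (check_found_ok _ (rep_lf r4) (rep_fnd r4))) => //.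
  by rewrite k14 //=; lia.
move=> m5 [k5 e12]; split.
  apply: keeps_trans (sub_keeps k14 _) (sub_keeps k5 _) => p;
  by rewrite /stable /outside !inE; lia.
rewrite /expand /= -news_from0.
by apply: rep_found r4 k5 _; rewrite e12.
Qed.

Lemma search_step_ok f0 st m : ctx m -> rep f0 st m -> stk st != [::] ->
  ok search_step_cmd m (n * 29 + 40) (fun m' => keeps stable m m' /\
    rep f0 (search_step a k K st) m').
Proof.
move=> cm rm; have Sb32 := Sb_ge32.
have [c0 ck c4 cM cS cT cK ca] := cm.
case: st rm => s X l dd w f rm; case: s rm => // u q rm _.
have /= e15 := rep_sp rm; have /= e18 := rep_d rm.
have eT : m (T + size q) = u.
  by rewrite (rep_stk rm) //= rev_cons map_rcons nth_rcons size_map size_rev ltnn eqxx.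
have popE : (size q).+1 - 1 = size q by rewrite subn1.
apply: (@ok_seq _ _ _ 7 (n * 29 + 33)); [|by lia].
blk; rewrite popE; set m1 := upd _ _ _.
have k1 : keeps (outside [:: 15; 19; 20; 23; 24]) m m1.
  by move=> p; rewrite /outside !inE => hp; rewrite /m1; rd.
have e15' : m1 15 = size q by rewrite /m1; rd.
have e19 : m1 19 = u by rewrite /m1; rd.
have e20 : m1 20 = 1 by rewrite /m1; rd.
have e23 : m1 23 = (dd - 1) + (1 - dd) by rewrite /m1; rd.
clearbody m1.
have r1 : rep f0 (State q X l dd w f) m1.
  have [h1 h2 h3 h4 h5 h6 h7 h8] := rm; split=> /=; try by rewrite k1.
  - by [].
  - move=> i lt; rewrite k1 ?h3 //=; last 2 first.
    + exact: ltnW.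
    + by rewrite /outside !inE; lia.
    by rewrite rev_cons map_rcons nth_rcons size_map size_rev lt.
  - by move=> v; rewrite k1 ?h4 // /outside !inE; lia.
rewrite /search_step /=; set bw := if dd == 1 then _ else _.
pose Mid m2 := [/\ rep f0 (State q X l dd bw.2 f) m2,
  keeps (outside [:: 2; 3; 15; 19; 20; 23; 24]) m m2, m2 20 = bw.1 & m2 19 = u].
apply: (@ok_seq _ _ _ 10 (n * 29 + 23)); last by lia.
apply: (@ok_weaken _ _ 10 _ Mid) => //.
  apply: (@ok_ifv _ _ _ _ _ 7); [exact: e23| | |by []] => c.
    have bwE : bw = next_bit K w by rewrite /bw ifF //; apply/eqP => dE; rewrite dE in c.
    have e2 : m1 2 = w by rewrite k1 // (rep_w rm).
    have e8 : m1 8 = K by rewrite k1.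
    apply: (ok_weaken (next_bit_ok e2 e8)) => // m2 [f2 f20 k2]; rewrite -bwE in f2 f20.
    have k2' : keeps (outside [:: 2; 3; 20; 23]) m1 (upd m2 3 0).
      by move=> p; rewrite /outside !inE => hp; rewrite upd_ne ?k2 // /outside ?inE //; lia.
    split; try by rd.
    + have [h1 h2 h3 h4 h5 h6 h7 h8] := r1; split=> /=; try by rewrite k2'.
      * by rd.
      * by move=> i lt; rewrite k2' ?h3 // /outside !inE; lia.
      * by move=> v; rewrite k2' ?h4 // /outside !inE; lia.
    + apply: keeps_trans (sub_keeps k1 _) (sub_keeps k2' _) => p;
      by rewrite /outside !inE; lia.
    + by rewrite k2'.
  have bwE : bw = (true, w) by rewrite /bw ifT //; apply/eqP; lia.
  apply: ok_block => //; apply: okb_nil; rewrite /Mid bwE; split=> //.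
  by apply: sub_keeps k1 _ => p; rewrite /outside !inE; lia.
move=> m2 [r2 k2 f20 f19].
have c2 : ctx m2 by apply: (ctx_keeps cm k2) => p; rewrite /outside ?inE; lia.
apply: (@ok_ifv _ _ _ _ _ (n * 29 + 12)); [exact: f20| | |lia].
  rewrite eqb0 negbK => ->.
  apply: (ok_weaken (expand_ok c2 f19 r2)) => // m3 [k3 r3]; split.
    move=> p st; have [hp ps] := andP st; rewrite upd_ne ?k3 ?k2 //.
      by move: ps; rewrite /outside !inE; lia.
    by apply: neq_eqF => pE; rewrite pE in ps.
  apply: (rep_keeps r3) => p; rewrite /outside !inE => hp; rd.
move/eqP; rewrite eqb0 => /negPf->; apply: ok_block => //; first by rewrite /=; lia.
sym_run; split.
  move=> p st; have [hp ps] := andP st; rewrite upd_ne ?k2 //.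
    by move: ps; rewrite /outside !inE; lia.
  by apply: neq_eqF => pE; rewrite pE in ps.
have [h1 h2 h3 h4 h5 h6 h7 h8] := r2; split=> //=; try by rd.
- by move=> i lt; rewrite -h3 //; rd.
- by move=> v; rewrite -h4 //; rd.
Qed.

Definition outer : pred nat :=
  fun p => (p < Sb) && (p \notin [:: 2; 3; 11; 12; 14; 15; 16; 17; 18; 19; 20; 21; 22; 23; 24]).

Lemma search_ok (f0 g0 : bool) (r : 'I_n) s m : ctx m ->
  m 10 = r -> m 13 = s -> m 12 = f0 -> m 11 = g0 ->
  ok search_cmd m (n * (n * 29 + 49) + 25) (fun m' =>
    [/\ keeps outer m m', m' 12 = f0 || fnd (search_end a k K r s) &
        m' 11 = g0 || (#|seen (search_end a k K r s)| == n)]).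
Proof.
move=> cm m10 m13 m12 m11; have Sb32 := Sb_ge32; have ltr := ltn_ord r.
have [c0 ck c4 cM cS cT cK ca] := cm.
apply: (@ok_seq _ _ _ 3 (n * (n * 29 + 49) + 22)); last by lia.
blk; rewrite !addn0; set m1 := upd _ _ _.
have k1 : keeps (outside [:: 2; 14; 18]) m m1.
  by move=> p; rewrite /outside !inE => hp; rewrite /m1; rd.
have e2 : m1 2 = s by rewrite /m1; rd.
have e14 : m1 14 = n by rewrite /m1; rd.
have e18 : m1 18 = 0 by rewrite /m1; rd.
clearbody m1.
pose Inv N m' := [/\ N <= n, m' 14 = N, forall v : 'I_n, N <= v -> m' (Sb + v) = 0 &
  keeps (fun p => (p < Sb) && (p \notin [:: 3; 14; 23])) m1 m'].
apply: (@ok_seq _ _ _ (n * 6 + 1) (n * (n * 29 + 43) + 21)); last by nia.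
have start : Inv n m1 by split=> // v; have := ltn_ord v; lia.
have loop := @ok_for 14 (Blk [:: IAdd 23 6 14; IStore 23 18]) 2 Inv _ _ n (n * 6 + 1) m1 start.
have low c : c < 25 -> c \notin [:: 3; 14; 23] ->
  (fun p => (p < Sb) && (p \notin [:: 3; 14; 23])) c by move=> lt -> /=; lia.
apply: (ok_weaken (loop _ _ _)) => // [N m'|N m'|m2].
- by move=> [_ e _ k2]; split=> //; rewrite k2 ?low // k1.
- move=> [le _ z k2]; have e6 : m' 6 = Sb by rewrite k2 ?low // k1.
  have e18' : m' 18 = 0 by rewrite k2 ?low.
  blk; split=> [||v|p]; [exact: ltnW|by rd| |].
    case: (ltngtP N v) => // [lt _|<- _]; last by rd.
    by apply: etrans (z v lt); rd.
  by rewrite !inE => hp; rewrite -k2 ?inE //; rd.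
move=> [_ _ z k2].
have k12 : keeps stable m m2.
  apply: keeps_trans (sub_keeps k1 _) (sub_keeps k2 _) => p;
  by rewrite /stable /outside !inE; lia.
have st c : c < 25 -> c \notin [:: 2; 3; 12; 14; 15; 16; 17; 18; 19; 20; 21; 22; 23; 24] ->
  stable c by rewrite /stable => lt -> ; lia.
have f6 : m2 6 = Sb by rewrite k12 ?st.
have f10 : m2 10 = r by rewrite k12 ?st.
have f4 : m2 4 = 1 by rewrite k12 ?st.
have f7 : m2 7 = T by rewrite k12 ?st.
have f1 : m2 1 = k by rewrite k12 ?st.
have f12 : m2 12 = f0 by rewrite k2 ?low // k1.
have f18 : m2 18 = 0 by rewrite k2 ?low.
have f2 : m2 2 = s by rewrite k2 ?low.
apply: (@ok_seq _ _ _ 6 (n * (n * 29 + 43) + 15)); last by lia.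
blk; set m3 := upd _ _ _.
have k23 : keeps (fun p => (p < Sb) && (p \notin [:: 15; 16; 17; 23])) m2 m3.
  by move=> p; rewrite !inE => hp; rewrite /m3; rd.
have z3 (v : 'I_n) : m3 (Sb + v) = (v == r).
  case: (eqVneq v r) => [->|vr]; first by rewrite /m3; rd.
  have neq : (v : nat) <> r by move=> /val_inj E; rewrite E eqxx in vr.
  by have ltv := ltn_ord v; apply: etrans (z v (leq0n v)); rewrite /m3; rd.
have t3 : m3 T = r by rewrite /m3; rd.
have f15 : m3 15 = 1 by rewrite /m3; rd.
have f16 : m3 16 = 1 by rewrite /m3; rd.
have f17 : m3 17 = 1 by rewrite /m3; rd.
clearbody m3.
have low3 c : c < 25 -> c \notin [:: 15; 16; 17; 23] ->
  (fun p => (p < Sb) && (p \notin [:: 15; 16; 17; 23])) c by move=> lt -> /=; lia.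
apply: (@ok_seq _ _ _ 5 (n * (n * 29 + 43) + 10)); last by lia.
have g1 : m3 1 = k by rewrite k23 ?low3.
have g12 : m3 12 = f0 by rewrite k23 ?low3.
apply: (ok_weaken (check_found_ok g1 f16 g12)) => // m4 [k34 h12].
have k14 : keeps stable m m4.
  apply: keeps_trans k12 _; apply: (@keeps_trans stable _ m3).
    by apply: sub_keeps k23 _ => p; rewrite /stable !inE; lia.
  by apply: sub_keeps k34 _ => p; rewrite /stable /outside !inE; lia.
have c4' : ctx m4 by apply: (ctx_keeps cm k14) => p; rewrite /stable ?inE; lia.
have r4 : rep f0 (search_init k r s) m4.
  split=> //=; try by rewrite k34 // ?k23 ?low3.
  - by case=> // _; rewrite addn0 k34 //= /outside !inE; lia.
  - by move=> v; rewrite inE k34 ?z3 // /outside !inE; lia.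
  - by rewrite cards1 k34.
apply: (@ok_seq _ _ _ (n * (n * 29 + 43) + 1) 9); last by lia.
pose Loop N m' := keeps stable m4 m' /\ exists st,
  [/\ rep f0 st m', mass st = N & iter N (search_step a k K) st = search_end a k K r s].
have start2 : Loop n m4.
  by split=> //; exists (search_init k r s); rewrite mass_init.
have step2 N m' : Loop N m' -> m' 15 != 0 -> exists2 N', N = N'.+1 &
    ok search_step_cmd m' (n * 29 + 40) (fun m'' => Loop N' (upd m'' 3 0)).
  move=> [k' [st' [r' mE itE]]] n0.
  have nn : stk st' != [::] by rewrite -size_eq0 -(rep_sp r').
  have mE' := mass_step a k K nn; exists (mass (search_step a k K st')); first by rewrite -mE.
  have c' : ctx m' by apply: (ctx_keeps c4' k') => p; rewrite /stable ?inE; lia.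
  apply: (ok_weaken (search_step_ok c' r' nn)) => // m'' [k'' r''].
  split.
    move=> p hp; rewrite upd_ne; first by rewrite k'' // k'.
    by apply: neq_eqF => pE; move: hp; rewrite pE /stable !inE andbF.
  exists (search_step a k K st'); split=> //.
    by apply: (rep_keeps r'') => p; rewrite /outside !inE => hp; rd.
  by rewrite -itE -mE mE' iterSr.
apply: (ok_weaken (ok_while step2 start2)); first by nia.
move=> m5 [e15 [N' [k45 [st5 [r5 mE5 itE5]]]]].
have st5E : st5 = search_end a k K r s.
  rewrite -itE5 stk_nil_iter //; apply/nilP; rewrite /nilp -(rep_sp r5) e15 //.
rewrite st5E in r5; apply: (@ok_seq _ _ _ 1 8) => //.
have k15 : keeps stable m m5 by apply: keeps_trans k14 k45.
have i0 : m5 0 = n by rewrite k15 ?st.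
have i17 := rep_tot r5.
have i11 : m5 11 = g0 by rewrite k15 ?st.
have i12 := rep_fnd r5.
have le_n := max_card (mem (seen (search_end a k K r s))); rewrite card_ord in le_n.
move: (#|_|) i17 le_n => tot i17 le_n.
have fin : keeps outer m m5 by apply: sub_keeps k15 _ => p; rewrite /outer /stable !inE; lia.
blk; apply: (@ok_ifv _ (n - tot) _ _ _ 2); [by rd| | |by []] => c; blk.
  rewrite (_ : (tot == n) = false) ?orbF; last by apply/eqP => E; rewrite E subnn in c.
  split; [|by rd|by rd].
  by move=> p; rewrite /outer !inE => hp; rewrite -fin /outer ?inE //; rd.
rewrite (_ : (tot == n) = true) ?orbT; last by apply/eqP; lia.
split; [|by rd|by rd].
by move=> p; rewrite /outer !inE => hp; rewrite -fin /outer ?inE //; rd.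
Qed.

Definition good (r : 'I_n) : bool :=
  has (fun s => #|seen (search_end a k K r s)| == n) (iota 0 K.+1) &&
  has (fun s => fnd (search_end a k K r s)) (iota 0 K.+1).

Lemma goodP r : reflect
  ((exists2 w, w <= K & #|seen (search_end a k K r w)| = n) /\
   (exists2 w, w <= K & fnd (search_end a k K r w))) (good r).
Proof.
have mem w : (w \in iota 0 K.+1) = (w <= K) by rewrite mem_iota.
apply: (iffP andP) => -[].
  move=> /hasP[w + /eqP E] /hasP[w' + F]; rewrite !mem => ? ?.
  by split; [exists w|exists w'].
move=> [w le E] [w' le' F]; split; apply/hasP.
  by exists w; rewrite ?mem ?E.
by exists w'; rewrite ?mem.
Qed.

Definition main_time : nat := n * (K.+1 * (n * (n * 29 + 49) + 29) + 15) + 6.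

Lemma main_ok m : ctx m ->
  ok main_cmd m main_time (fun m' => m' 0 = [exists r, good r]).
Proof.
move=> cm; have Sb32 := Sb_ge32.
pose TB := K.+1 * (n * (n * 29 + 49) + 29) + 11.
have [c0 ck c4 cM cS cT cK ca] := cm.
apply: (@ok_seq _ _ _ 3 (n * (TB + 4) + 3)); last by rewrite /TB /main_time; lia.
blk; rewrite addn0; set m1 := upd _ _ _.
have k1 : keeps (outside [:: 9; 10; 18]) m m1.
  by move=> p; rewrite /outside !inE => hp; rewrite /m1; rd.
have c1 : ctx m1 by apply: (ctx_keeps cm k1) => p; rewrite /outside ?inE; lia.
have e9 : m1 9 = 0 by rewrite /m1; rd.
have e10 : m1 10 = n by rewrite /m1; rd.
clearbody m1; clear c0 ck c4 cM cS cT cK ca.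
pose Inv N m' := [/\ N <= n, m' 10 = N, ctx m' & m' 9 = [exists r : 'I_n, (N <= r) && good r]].
have start : Inv n m1.
  split=> //; rewrite e9; case: existsP => // -[r]; by have := ltn_ord r; lia.
apply: (@ok_seq _ _ _ (n * (TB + 4) + 1) 2); last by lia.
have loop := @ok_for 10 _ TB Inv _ _ n (n * (TB + 4) + 1) m1 start.
apply: (ok_weaken (loop _ _ _ _)) => // {loop start m1 k1 c1 e9 e10} [N m'|N m1|m1].
- by move=> [_ e c _]; split=> //; apply: (ctx_1 c).
- move=> [ltN _ cm1 e9].
  have [c0 ck c4 cM cS cT cK ca] := cm1.
  pose r := Ordinal ltN.
  apply: (@ok_seq _ _ _ 3 (TB - 3)); last by rewrite /TB; lia.
  blk; set m2 := upd _ _ _.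
  have k2 : keeps (outside [:: 10; 11; 12; 13]) m1 m2.
    by move=> p; rewrite /outside !inE => hp; rewrite /m2; rd.
  have f10 : m2 10 = r by rewrite /m2; rd.
  have f11 : m2 11 = 0 by rewrite /m2; rd.
  have f12 : m2 12 = 0 by rewrite /m2; rd.
  have f13 : m2 13 = K.+1 by rewrite /m2 addn1; rd.
  clearbody m2.
  pose rest s := iota s (K.+1 - s).
  pose In s m' := [/\ s <= K.+1, m' 13 = s,
    keeps (fun p => (p < Sb) && (p \notin [:: 2; 3; 11; 12; 13; 14; 15; 16; 17; 18; 19; 20; 21; 22; 23; 24])) m2 m',
    m' 12 = has (fun s => fnd (search_end a k K r s)) (rest s) &
    m' 11 = has (fun s => #|seen (search_end a k K r s)| == n) (rest s)].
  have ctxI s m' : In s m' -> ctx m'.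
    move=> [_ _ k' _ _]; apply: (ctx_keeps (ctx_keeps cm1 k2 _ _) k') => p;
    rewrite /outside ?inE; lia.
  have start : In K.+1 m2 by split=> //; rewrite /rest subnn /=.
  have loop := @ok_for 13 search_cmd (n * (n * 29 + 49) + 25) In _ _ K.+1 (TB - 10) m2 start.
  apply: (@ok_seq _ _ _ (TB - 10) 7); last by rewrite /TB; lia.
  apply: (ok_weaken (loop _ _ _)) => // [s m'|s m'||m3].
  + by move=> inv; split; [case: inv|exact: ctx_1 (ctxI _ _ inv)].
  + move=> inv; have c' := ctxI _ _ inv; case: inv => le _ k' h12 h11.
    have kr : keeps (outside [:: 13]) m' (upd m' 13 s).
      by move=> p; rewrite /outside inE => hp; rd.
    have cr : ctx (upd m' 13 s) by apply: (ctx_keeps c' kr) => p; rewrite /outside ?inE; lia.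
    have r10 : upd m' 13 s 10 = r by rewrite upd_ne // k' //= ?inE; lia.
    have restE : rest s = s :: rest s.+1 by rewrite /rest subSn //= subSS.
    apply: (ok_weaken (search_ok cr r10 _ h12 h11)) => // m'' [k'' g12 g11]; split.
    * exact: ltnW.
    * by rewrite upd_ne // k'' ?upd_eq // /outer !inE; lia.
    * move=> p hp; rewrite upd_ne; last by apply: neq_eqF => pE; move: hp; rewrite pE !inE andbF.
      rewrite k''; last by move: hp; rewrite /outer !inE; lia.
      rewrite upd_ne ?k' //; by apply: neq_eqF => pE; move: hp; rewrite pE !inE !orbT andbF.
    * by rewrite restE /= orbC; rd.
    * by rewrite restE /= orbC; rd.
  + by rewrite /TB; lia.
  move=> inv; have c3 := ctxI _ _ inv; case: inv => _ _ k3 h12 h11.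
  rewrite /rest subn0 in h12 h11.
  have k13 : keeps (fun p => p \in [:: 9; 10]) m2 m3 by move=> p; rewrite !inE => hp; rewrite k3 // !inE; lia.
  have i10 : m3 10 = N by rewrite k13.
  have i9 : m3 9 = [exists r : 'I_n, (N.+1 <= r) && good r] by rewrite k13 // k2.
  have exE : [exists r : 'I_n, (N <= r) && good r] =
      good r || [exists r : 'I_n, (N.+1 <= r) && good r].
    apply/existsP/orP => [[v /andP[lev gv]]|[gr|/existsP[v /andP[lev gv]]]].
    - case: (ltngtP N v) lev => // [lt _|E _]; first by right; apply/existsP; exists v; rewrite lt.
      by left; rewrite (_ : r = v) //; apply: val_inj.
    - by exists r; rewrite /= leqnn.
    - by exists v; rewrite gv ltnW.
  have nogood m' : good r = false -> keeps (outside [:: 3]) m3 m' -> Inv N m'.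
    move=> ng k'; split; rewrite ?exE ?ng ?k' //; first exact: ltnW.
    by apply: (ctx_keeps c3 k') => p; rewrite /outside ?inE; lia.
  have goodE : good r = (m3 11 != 0) && (m3 12 != 0).
    by rewrite /good -/(iota _ _) h11 h12 !eqb0 !negbK.
  apply: (@ok_if _ _ _ _ 4) => // f11n.
    apply: (@ok_if _ _ _ _ 1) => // f12n; blk.
      split; [exact: ltnW|by rd| |].
        apply: (@ctx_keeps (outside [:: 3; 9]) _ _ c3) => p.
        - by rewrite /outside !inE => hp; rd.
        - by rewrite /outside !inE; lia.
        - by rewrite /outside !inE; lia.
      by rewrite exE goodE f11n f12n /=; rd.
    apply: nogood; first by rewrite goodE f12n andbF.
    by move=> p; rewrite /outside !inE => hp; rd.
  blk; apply: nogood; first by rewrite goodE f11n.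
  by move=> p; rewrite /outside !inE => hp; rd.
move=> [_ _ c3 e9].
have c4 := ctx_1 c3.
blk; rewrite addn0; rd.
Qed.

End Correctness.

(** * Relocating the input *)

Lemma frac_rcons bs b :
  frac (size bs).+1 (rcons bs b) = frac (size bs) bs + frac (size bs) bs + b.
Proof.
elim: bs => [|c bs IH]; first by case: b.
by rewrite /= in IH *; rewrite IH expnS; case: c; lia.
Qed.

(* The input fills the low registers, which the program needs as its variables:
   their bits are first packed into register 2, and unpacked after the rest of
   the matrix has been moved away. *)
Fixpoint pack_block (j : nat) : seq instr :=
  if j is j'.+1 then pack_block j' ++ [:: IAdd 2 2 2; IAdd 2 2 (3 + j')] else [::].

Lemma run_block_cat b1 b2 m : run_block (b1 ++ b2) m = run_block b2 (run_block b1 m).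
Proof. by elim: b1 m => //= i b1 IH m; rewrite IH. Qed.

Lemma run_pack (b : nat -> bool) j (m : memory) : (forall i, i <= j -> m (2 + i) = b i) ->
  run_block (pack_block j) m 2 = frac j.+1 (map b (iota 0 j.+1)) /\
  keeps (outside [:: 2]) m (run_block (pack_block j) m).
Proof.
elim: j => [|j IH] bits; first by split=> //=; rewrite (bits 0) // expn0; case: (b 0).
have [|e2 km] := IH; first by move=> i le; apply: bits; apply: leqW.
rewrite [pack_block _.+1]/= run_block_cat; set m' := run_block _ m in e2 km *.
have e3 : m' (3 + j) = b j.+1 by rewrite km -?bits ?addnS // /outside !inE; lia.
split; last by move=> p hp; rewrite /= -km //; move: hp; rewrite /outside !inE => hp; rewrite !upd_ne //; apply/negbTE.
have -> : map b (iota 0 j.+2) = rcons (map b (iota 0 j.+1)) (b j.+1).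
  by rewrite -[in LHS]addn1 iotaD map_cat cats1.
have := frac_rcons (map b (iota 0 j.+1)) (b j.+1); rewrite size_map size_iota => ->.
by rewrite -e2 -e3.
Qed.

Definition double_cmd : cmd := For 14 (Blk [:: IAdd 8 8 8]).

Lemma double_ok L m : m 4 = 1 -> m 14 = L -> m 8 = 1 ->
  ok double_cmd m (L * 5 + 1) (fun m' => m' 8 = 2 ^ L /\ keeps (outside [:: 3; 8; 14]) m m').
Proof.
move=> m4 m14 m8.
pose Inv N m' := [/\ N <= L, m' 14 = N, m' 8 = 2 ^ (L - N) & keeps (outside [:: 3; 8; 14]) m m'].
have start : Inv L m by split; rewrite ?subnn.
have loop := @ok_for 14 (Blk [:: IAdd 8 8 8]) 1 Inv _ _ L (L * 5 + 1) m start.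
apply: (ok_weaken (loop _ _ _)) => // [N m'|N m'|m'].
- by move=> [_ e _ km]; split=> //; rewrite km.
- move=> [le _ e8 km]; blk; split=> [||//|p]; [exact: ltnW|by rd| |].
    by rewrite (_ : L - N = (L - N.+1).+1) ?expnS ?mul2n -?addnn; [rd|lia].
  by rewrite /outside !inE => hp; rewrite -km /outside ?inE //; rd.
- by case=> [_ _]; rewrite subn0.
Qed.

Definition copy_cmd : cmd :=
  For 14 (Blk [:: IConst 24 2; IAdd 24 24 14; ILoad 22 24; IAdd 24 5 14; IStore 24 22]).

Lemma copy_ok L M m : L + 32 <= M -> m 4 = 1 -> m 14 = L -> m 5 = M ->
  ok copy_cmd m (L * 9 + 1) (fun m' =>
    (forall i, 30 <= i < L -> m' (M + i) = m (2 + i)) /\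
    keeps (fun p => (p < M) && (p \notin [:: 3; 14; 22; 24])) m m').
Proof.
move=> LM m4 m14 m5.
pose Inv N m' := [/\ N <= L, m' 14 = N,
  forall i, N <= i -> 30 <= i < L -> m' (M + i) = m (2 + i) &
  keeps (fun p => (p < M) && (p \notin [:: 3; 14; 22; 24])) m m'].
have start : Inv L m by split=> // i; lia.
have loop := @ok_for 14 _ 5 Inv _ _ L (L * 9 + 1) m start.
apply: (ok_weaken (loop _ _ _ _)) => // [N m'|N m'|m'].
- by move=> [_ e _ km]; split=> //; rewrite km //=; lia.
- move=> [le _ e km].
  have e5 : m' 5 = M by rewrite km //=; lia.
  blk; split=> [||i lei Hi|p]; [exact: ltnW|by rd| |].
    case: (ltngtP N i) lei Hi => // [lt _ Hi|<- _ Hi]; first by apply: etrans (e i lt Hi); rd.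
    have hk : m' (2 + N) = m (2 + N) by rewrite km // !inE; lia.
    rd.
  by rewrite !inE => hp; rewrite -km ?inE //; rd.
- by move=> [_ _ e km]; split=> // i; apply: e.
Qed.

Definition decode_cmd : cmd :=
  For 14 (Seq next_bit_cmd (Blk [:: IStore 21 20; IAdd 21 21 4])).

Lemma decode_ok bs M m : let L := size bs in
  32 <= M -> m 4 = 1 -> m 14 = L -> m 21 = M -> m 2 = frac L bs -> m 8 = 2 ^ L ->
  ok decode_cmd m (L * 13 + 1) (fun m' =>
    (forall i, i < L -> m' (M + i) = nth false bs i) /\
    keeps (fun p => ((p < M) || (M + L <= p)) && (p \notin [:: 2; 3; 14; 20; 21; 23])) m m').
Proof.
move=> L M32 m4 m14 m21 m2 m8.
pose A : pred nat := fun p => ((p < M) || (M + L <= p)) && (p \notin [:: 2; 3; 14; 20; 21; 23]).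
pose Inv N m' := [/\ N <= L /\ m' 14 = N, m' 21 = M + (L - N), m' 2 = frac L (drop (L - N) bs),
  forall i, i < L - N -> m' (M + i) = nth false bs i & keeps A m m'].
have start : Inv L m by split; rewrite ?subnn ?addn0 ?drop0.
have loop := @ok_for 14 _ 9 Inv _ _ L (L * 13 + 1) m start.
apply: (ok_weaken (loop _ _ _ _)) => // [N m'|N m'|m'].
- by move=> [[_ e] _ _ _ km]; split=> //; rewrite km // /A /=; lia.
- move=> [[le _] e21 e2 e km].
  have f8 : upd m' 14 N 8 = 2 ^ L by rewrite upd_ne // km // /A /=; lia.
  have f4 : m' 4 = 1 by rewrite km // /A /=; lia.
  have f2 : upd m' 14 N 2 = frac L (drop (L - N.+1) bs) by rewrite upd_ne.
  have dE : drop (L - N.+1) bs = nth false bs (L - N.+1) :: drop (L - N) bs.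
    by rewrite (drop_nth false) -?subSn ?subSS // /L; lia.
  have nbE : next_bit (2 ^ L) (frac L (drop (L - N.+1) bs)) =
      (nth false bs (L - N.+1), frac L (drop (L - N) bs)).
    by rewrite dE next_bit_frac // size_drop -/L; lia.
  apply: (@ok_seq _ _ _ 7 2) => //.
  apply: (ok_weaken (next_bit_ok f2 f8)) => // m1 [g2 g20 k1].
  rewrite nbE /= in g2 g20.
  have g21 : m1 21 = M + (L - N.+1) by rewrite k1 //; rd.
  have g4 : m1 4 = 1 by rewrite k1 //; rd.
  have g14 : m1 14 = N by rewrite k1 //; rd.
  have S1 : (L - N.+1).+1 = L - N by rewrite -subSn // subSS.
  blk; split.
  + by split; [exact: ltnW|rd].
  + by rewrite (_ : M + (L - N) = M + (L - N.+1) + 1); [rd|lia].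
  + by rd.
  + move=> i; rewrite -S1 ltnS => lei; case: (ltngtP i (L - N.+1)) lei => // [lt _|-> _]; last by rd.
    apply: etrans (e i lt).
    have hk : m1 (M + i) = m' (M + i) by rewrite k1 ?upd_ne // ?/outside ?inE; [apply: neq_eqF; lia|lia].
    by rewrite -hk; rd.
  + move=> p; rewrite /A !inE => hp.
    have hk : m1 p = m p by rewrite k1 ?upd_ne ?km // ?/outside ?/A ?inE; [lia|apply: neq_eqF; lia|lia].
    by rewrite -hk; rd.
- by move=> [_ _ _ e km]; split=> // i lt; apply: e; rewrite subn0.
Qed.

Lemma encode_cell n (a : rel 'I_n) k (u v : 'I_n) : encode a k (2 + (u * n + v)) = a u v.
Proof.
have n0 : 0 < n by apply: leq_ltn_trans (ltn_ord u).
rewrite /encode /= addKn; have -> : u * n + v < n * n by have := ltn_ord u; have := ltn_ord v; nia.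
by rewrite divnMDl // divn_small // addn0 modnMDl modn_small // !valK.
Qed.

Lemma encode_bit n (a : rel 'I_n) k i :
  encode a k (2 + i) = (encode a k (2 + i) != 0) :> nat.
Proof.
rewrite /encode /=; case: ifP => // _.
by case: insub => // u; case: insub => // v; case: (a u v).
Qed.

Definition prep_cmd : cmd :=
  Seq (Blk (pack_block 29))
  (Seq (Blk [:: IConst 4 1; IConst 18 0; IConst 14 30; IConst 8 1])
  (Seq double_cmd
  (Seq (Blk [:: IAdd 14 0 18; IConst 23 0])
  (Seq (For 14 (Blk [:: IAdd 23 23 0]))
  (Seq (Blk [:: IConst 24 32; IAdd 5 23 24; IAdd 6 5 23; IAdd 6 6 24; IAdd 7 6 0;
                IAdd 14 23 18])
  (Seq copy_cmd
  (Seq (Blk [:: IConst 14 30; IAdd 21 5 18])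
  (Seq decode_cmd
  (Seq (Blk [:: IConst 8 1; IAdd 14 1 1]) double_cmd))))))))).

Lemma square_ok n m : m 0 = n -> m 4 = 1 -> m 14 = n -> m 23 = 0 ->
  ok (For 14 (Blk [:: IAdd 23 23 0])) m (n * 5 + 1) (fun m' =>
    m' 23 = n * n /\ keeps (outside [:: 3; 14; 23]) m m').
Proof.
move=> m0 m4 m14 m23.
pose Inv N m' := [/\ N <= n, m' 14 = N, m' 23 = (n - N) * n & keeps (outside [:: 3; 14; 23]) m m'].
have start : Inv n m by split; rewrite ?subnn.
have loop := @ok_for 14 _ 1 Inv _ _ n (n * 5 + 1) m start.
apply: (ok_weaken (loop _ _ _ _)) => // [N m'|N m'|m'].
- by move=> [_ e _ km]; split=> //; rewrite km.
- move=> [le _ e km]; have e0 : m' 0 = n by rewrite km.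
  blk; split=> [||//|p]; [exact: ltnW|by rd| |].
    by rewrite (_ : n - N = (n - N.+1).+1) ?mulSnr; [rd|lia].
  by rewrite /outside !inE => hp; rewrite -km /outside ?inE //; rd.
- by case=> [_ _]; rewrite subn0.
Qed.

Definition matrix_base n := n * n + 32.
Definition seen_base n := matrix_base n + n * n + 32.
Definition stack_base n := seen_base n + n.

Lemma prep_ok n (a : rel 'I_n) k :
  ok prep_cmd (encode a k) (n * n * 9 + n * 5 + k * 10 + 700)
    (ctx a k (2 ^ (k + k)) (matrix_base n) (seen_base n) (stack_base n)).
Proof.
pose m0 := encode a k.
pose b i := m0 (2 + i) != 0.
pose bs := map b (iota 0 30).
have szbs : size bs = 30 by rewrite size_map size_iota.
have nbs i : i < 30 -> nth false bs i = m0 (2 + i) :> nat.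
  by move=> lt; rewrite (nth_map 0) ?size_iota // nth_iota // -encode_bit.
have cells (u v : 'I_n) : m0 (2 + (u * n + v)) = a u v by apply: encode_cell.
have x0 : m0 0 = n by [].
have x1 : m0 1 = k by [].
have [|y2 y] := run_pack (b := b) (j := 29) (m := m0); first by move=> i _; apply: encode_bit.
rewrite -/bs in y2.
apply: (@ok_seq _ _ _ 58 (n * n * 9 + n * 5 + k * 10 + 642)); last by lia.
apply: ok_block => //; rewrite /okb -/m0.
set m1 := run_block _ _ in y y2 *.
have {x0} x0 : m1 0 = n by rewrite y.
have {x1} x1 : m1 1 = k by rewrite y.
have {cells} cells (u v : 'I_n) : 30 <= u * n + v -> m1 (2 + (u * n + v)) = a u v.
  by move=> le; rewrite y // /outside inE; lia.
have {nbs} nbs (u v : 'I_n) : u * n + v < 30 -> nth false bs (u * n + v) = a u v.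
  by move=> lt; move: (nbs _ lt); rewrite /m0 encode_cell; case: nth; case: (a u v).
clearbody m1 bs; clear y b m0.
apply: (@ok_seq _ _ _ 4 (n * n * 9 + n * 5 + k * 10 + 638)); last by lia.
blk; set m2 := upd _ _ _.
have k12 : keeps (outside [:: 4; 8; 14; 18]) m1 m2.
  by move=> p; rewrite /outside !inE => hp; rewrite /m2; rd.
have z4 : m2 4 = 1 by rewrite /m2; rd.
have z14 : m2 14 = 30 by rewrite /m2; rd.
have z8 : m2 8 = 1 by rewrite /m2; rd.
have z18 : m2 18 = 0 by rewrite /m2; rd.
clearbody m2.
apply: (@ok_seq _ _ _ 151 (n * n * 9 + n * 5 + k * 10 + 487)); last by lia.
apply: (ok_weaken (double_ok z4 z14 z8)) => // m3 [w8 k23].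
have k13 : keeps (outside [:: 3; 4; 8; 14; 18]) m1 m3.
  by apply: keeps_trans (sub_keeps k12 _) (sub_keeps k23 _) => p; rewrite /outside !inE; lia.
have w18 : m3 18 = 0 by rewrite k23.
have w0 : m3 0 = n by rewrite k13.
apply: (@ok_seq _ _ _ 2 (n * n * 9 + n * 5 + k * 10 + 485)); last by lia.
blk; rewrite addn0; set m4 := upd _ _ _.
have k14 : keeps (outside [:: 3; 4; 8; 14; 18; 23]) m1 m4.
  by move=> p; rewrite /outside !inE => hp; rewrite -k13 ?/m4 /outside ?inE; [rd|lia].
have z4' : m4 4 = 1 by rewrite /m4; do 2 (rewrite upd_ne //); rewrite k23.
have w8' : m4 8 = 2 ^ 30 by rewrite /m4; rd.
have w18' : m4 18 = 0 by rewrite /m4; rd.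
have z14' : m4 14 = n by rewrite /m4; rd.
have z23' : m4 23 = 0 by rewrite /m4; rd.
have {w0} w0 : m4 0 = n by rewrite /m4; rd.
clearbody m4; clear k13 k12 k23 m2 m3 z4 z14 z8 z18 w8 w18.
apply: (@ok_seq _ _ _ (n * 5 + 1) (n * n * 9 + k * 10 + 484)); last by lia.
apply: (ok_weaken (square_ok w0 z4' z14' z23')) => // m5 [e23 k45].
have k15 : keeps (outside [:: 3; 4; 8; 14; 18; 23]) m1 m5.
  by apply: keeps_trans (sub_keeps k14 _) (sub_keeps k45 _) => p; rewrite /outside !inE; lia.
have e0 : m5 0 = n by rewrite k45.
have e18 : m5 18 = 0 by rewrite k45.
have e8 : m5 8 = 2 ^ 30 by rewrite k45.
have e4 : m5 4 = 1 by rewrite k45.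
apply: (@ok_seq _ _ _ 6 (n * n * 9 + k * 10 + 478)); last by lia.
blk; rewrite !addn0 -/(matrix_base n) -/(seen_base n) -/(stack_base n).
set m6 := upd _ _ _.
have k16 : keeps (outside [:: 3; 4; 5; 6; 7; 8; 14; 18; 23; 24]) m1 m6.
  by move=> p; rewrite /outside !inE => hp; rewrite -k15 ?/m6 /outside ?inE; [rd|lia].
have f0 : m6 0 = n by rewrite /m6; rd.
have f18 : m6 18 = 0 by rewrite /m6; rd.
have f8 : m6 8 = 2 ^ 30 by rewrite /m6; rd.
have f4 : m6 4 = 1 by rewrite /m6; rd.
have f14 : m6 14 = n * n by rewrite /m6; rd.
have f5 : m6 5 = matrix_base n by rewrite /m6; rd.
have f6 : m6 6 = seen_base n by rewrite /m6; rd.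
have f7 : m6 7 = stack_base n by rewrite /m6; rd.
clearbody m6; clear m4 m5 k14 k45 k15 z4' w8' w18' z14' z23' w0 e0 e18 e8 e4 e23.
apply: (@ok_seq _ _ _ (n * n * 9 + 1) (k * 10 + 477)); last by lia.
apply: (ok_weaken (copy_ok (leqnn _) f4 f14 f5)) => // m7 [copied k67].
have low7 c : c < 32 -> c \notin [:: 3; 14; 22; 24] ->
    (fun p => (p < n * n + 32) && (p \notin [:: 3; 14; 22; 24])) c.
  by move=> lt -> /=; lia.
have M_ge : 32 <= matrix_base n by rewrite /matrix_base; lia.
have g2 : m7 2 = frac 30 bs by rewrite k67 ?low7 // k16.
have g0 : m7 0 = n by rewrite k67 ?low7.
have g1 : m7 1 = k by rewrite k67 ?low7 // k16.
have g4 : m7 4 = 1 by rewrite k67 ?low7.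
have g5 : m7 5 = matrix_base n by rewrite k67 ?low7.
have g6 : m7 6 = seen_base n by rewrite k67 ?low7.
have g7 : m7 7 = stack_base n by rewrite k67 ?low7.
have g8 : m7 8 = 2 ^ 30 by rewrite k67 ?low7.
have g18 : m7 18 = 0 by rewrite k67 ?low7.
have cells7 (u v : 'I_n) : 30 <= u * n + v -> m7 (matrix_base n + (u * n + v)) = a u v.
  have lt : u * n + v < n * n by have := ltn_ord u; have := ltn_ord v; nia.
  by move=> le; rewrite copied ?le // k16 ?cells // /outside !inE; lia.
clear k16 k67 low7 copied cells f0 f18 f8 f4 f14 f5 f6 f7 y2 x0 x1 m1 m6.
apply: (@ok_seq _ _ _ 2 (k * 10 + 475)); last by lia.
blk; rewrite addn0; set m8 := upd _ _ _.
have k78 : keeps (outside [:: 14; 21]) m7 m8.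
  by move=> p; rewrite /outside !inE => hp; rewrite /m8; rd.
have h14 : m8 14 = size bs by rewrite szbs /m8; rd.
have h21 : m8 21 = matrix_base n by rewrite /m8; rd.
have h2 : m8 2 = frac (size bs) bs by rewrite szbs k78.
have h8 : m8 8 = 2 ^ size bs by rewrite szbs k78.
have h4 : m8 4 = 1 by rewrite k78.
clearbody m8.
apply: (@ok_seq _ _ _ (size bs * 13 + 1) (k * 10 + 84)); last by rewrite szbs; lia.
apply: (ok_weaken (decode_ok M_ge h4 h14 h21 h2 h8)) => // m9 [decoded k89].
have keep c : c < 32 -> c \notin [:: 2; 3; 14; 20; 21; 23] -> m9 c = m7 c.
  move=> lt hc; rewrite k89; last by rewrite hc andbT; apply/orP; left; lia.
  by rewrite k78 // /outside; move: hc; rewrite !inE; lia.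
have i4 : m9 4 = 1 by rewrite keep.
have i1 : m9 1 = k by rewrite keep.
apply: (@ok_seq _ _ _ 2 (k * 10 + 82)); last by lia.
blk; set m10 := upd _ _ _.
have k910 : keeps (outside [:: 8; 14]) m9 m10.
  by move=> p; rewrite /outside !inE => hp; rewrite /m10; rd.
have j4 : m10 4 = 1 by rewrite k910.
have j14 : m10 14 = k + k by rewrite /m10; rd.
have j8 : m10 8 = 1 by rewrite /m10; rd.
clearbody m10.
apply: (ok_weaken (double_ok j4 j14 j8)); first by lia.
move=> m11 [l8 k1011].
have keep11 c : c < 32 -> c \notin [:: 2; 3; 8; 14; 20; 21; 23] -> m11 c = m7 c.
  move=> lt hc; rewrite k1011 ?k910 ?keep // /outside; move: hc; rewrite !inE; lia.
split=> //; try by rewrite keep11.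
move=> u v; have lt : u * n + v < n * n by have := ltn_ord u; have := ltn_ord v; nia.
rewrite k1011; last by rewrite /outside !inE; lia.
rewrite k910; last by rewrite /outside !inE; lia.
case: (ltnP (u * n + v) 30) => [lt30|ge30]; first by rewrite decoded ?szbs // nbs.
rewrite k89 ?k78 ?cells7 // ?/outside ?inE ?szbs; first by lia.
by apply/andP; split; [apply/orP; right; lia|lia].
Qed.

Definition leafy_cmd : cmd := Seq prep_cmd main_cmd.

Lemma pow4_le k : 0 < k -> 2 ^ (k + k) <= 4 * k ^ (k + k).
Proof.
case: k => [//|[_|k _]]; first by rewrite exp1n.
by apply: leq_trans (leq_pmull _ _) => //; rewrite leq_exp2r.
Qed.

Lemma time_le n k c : 0 < k -> 4000 <= c ->
  n * n * 9 + n * 5 + k * 10 + 700 + main_time n (2 ^ (k + k)) <=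
  c * k ^ (c * k) * n.+1 ^ c.
Proof.
move=> k0 c_ge.
have kK : k <= 2 ^ (k + k).
  by apply: leq_trans (ltnW (ltn_expl k (ltnSn 1))) _; rewrite leq_exp2l // leq_addr.
have K4 := pow4_le k0.
have le1 : k ^ (k + k) <= k ^ (c * k) by apply: leq_pexp2l => //; nia.
have le3 : n.+1 ^ 3 <= n.+1 ^ c by apply: leq_pexp2l => //; lia.
apply: (@leq_trans (4000 * k ^ (k + k) * n.+1 ^ 3)); last first.
  by apply: leq_mul le3; apply: leq_mul.
apply: (@leq_trans (1000 * 2 ^ (k + k) * n.+1 ^ 3)); last first.
  by apply: leq_mul => //; move: (k ^ _) (2 ^ _) K4 => x y; lia.
move: (2 ^ (k + k)) kK => K kK; rewrite /main_time !expnS expn0 muln1.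
have K1 : 1 <= K by apply: leq_trans kK.
set X := n.+1 * _; set Y := n * (n * 29 + 49) + 29.
have X3 : n * (n * n) <= X by rewrite /X !leq_mul.
have X2 : n * n <= X.
  by rewrite /X leq_mul // (leq_trans (leqnSn n)) // leq_pmulr.
have X1 : n < X by rewrite /X leq_pmulr // muln_gt0.
have Y_le : n * Y <= 107 * X by rewrite /Y; move: (X) X1 X2 X3 => Z; lia.
have KY : K.+1 * (n * Y) <= 2 * K * (107 * X) by apply: leq_mul Y_le; lia.
have KX : X <= K * X by apply: leq_pmull.
have KK : K <= K * X by apply: leq_pmulr; apply: leq_trans X1.
rewrite mulnDr mulnCA; move: (n * Y) (X) Y_le KY KX KK X1 X2 => W Z; lia.
Qed.

(* There is a (uniform) RAM program P and a constant c such that on every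
   digraph D on n vertices and every positive integer k, P halts within
   c * k^(c*k) * (n+1)^c = 2^(O(k log k)) * n^(O(1)) steps and outputs 1
   exactly when D has an out-branching with at least k leaves. *)
Theorem theorem2 :
  exists (P : seq instr) (c : nat),
    forall (n : nat) (a : rel 'I_n) (k : nat), 0 < k ->
      exists m : memory,
        exec P (c * k ^ (c * k) * n.+1 ^ c) 0 (encode a k) = Some m /\
        (m 0 = 1 <-> has_k_leaf_out_branching a k).
Proof.
have [c c_ge] : exists c, 4000 <= c by exists 4000.
exists (compile leafy_cmd 0), c => n a k k0.
have [t [m [le ev e0]]] : ok leafy_cmd (encode a k)
    (n * n * 9 + n * 5 + k * 10 + 700 + main_time n (2 ^ (k + k)))
    (fun m' => m' 0 = [exists r, good a k (2 ^ (k + k)) r]).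
  apply: ok_seq (leqnn _); apply: (ok_weaken (prep_ok a k)) => // m c_m.
  apply: main_ok c_m => //; first by rewrite /matrix_base; lia.
  by rewrite /seen_base leq_addr.
exists m; split; first exact: compile_exec ev (leq_trans le (time_le n k0 c_ge)).
rewrite e0 addnn -mul2n (search_correct a k0).
case: existsP => [[r /goodP gr]|no]; split=> //; first by exists r.
by case=> r /goodP gr; case: no; exists r.
Qed.
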